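(* Let $(x^*,u^* )$ be a local solution of problem (P) with radius $\delta>0$. Then for every $k>0$ the regularized optimal control problem $(P_k)$ admits a global solution $(x_k,u_k)$.
   Context: Let $n,m\ge1$, $T>0$, $\tau>0$, $I=[0,T]$, $I_\tau=[-\tau,T]$. For $x\in C(I_\tau;\mathbb{R}^n)$, $t\in I$: $\max x_t:=\max_{s\in[t-\tau,t]}x(s)$ and $\mathrm{LIE}_k(x_t):=\frac1k\log\big(\int_{t-\tau}^t\exp(kx(s))\,\mathrm{d}s\big)$, both componentwise. Standing assumptions: $F(x,v,u)=F_0(x,v)+F_1(x,v)u$ with $F_0:\mathbb{R}^n\times\mathbb{R}^n\to\mathbb{R}^n$, $F_1:\mathbb{R}^n\times\mathbb{R}^n\to\mathbb{R}^{n\times m}$ globally Lipschitz and $C^1$; $\phi\in C([-\tau,0];\mathbb{R}^n)$; $U\subset\mathbb{R}^m$ nonempty convex compact; $j:I\times\mathbb{R}^n\times\mathbb{R}^m\to\mathbb{R}$ a nonnegative normal integrand, convex in its third argument, differentiable in its second argument with $j_x$ continuous in the second and third arguments. Feasible controls: $u\in L^\infty(I;\mathbb{R}^m)$ with $u(t)\in U$ a.e. Problem (P): minimize $J(x,u)=\int_0^Tj(t,x(t),u(t))\,\mathrm{d}t$ over feasible $u$, where $x\in C(I_\tau;\mathbb{R}^n)\cap W^{1,\infty}(I;\mathbb{R}^n)$ solves $x'(t)=F(x(t),\max x_t,u(t))$ a.e. on $(0,T)$, $x=\phi$ on $[-\tau,0]$. A local solution of (P) with radius $\delta>0$: feasible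 $u^*$ with state $x^*$ such that $J(x^*,u^* )\le J(x,u)$ for all feasible $u$ with $\|u-u^*\|_{L^2(I;\mathbb{R}^m)}\le\delta$. Problem $(P_k)$: minimize $J(x,u)+\frac12\|u-u^*\|^2_{L^2(I;\mathbb{R}^m)}=\int_0^T j(t,x(t),u(t))+\frac12|u(t)-u^*(t)|^2\,\mathrm{d}t$ over feasible $u$ with $\|u-u^*\|_{L^2(I;\mathbb{R}^m)}\le\delta$, where $x$ solves the regularized equation $x'(t)=F(x(t),\mathrm{LIE}_k(x_t),u(t))$ a.e. on $I$, $x=\phi$ on $[-\tau,0]$. *)

(* Defs.v *)
From HB Require Import structures.
From mathcomp Require Import all_boot all_order all_algebra.
From mathcomp Require Import all_classical all_reals all_analysis.
Set Implicit Arguments. Unset Strict Implicit. Unset Printing Implicit Defensive.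
Import Order.TTheory GRing.Theory Num.Theory.
Import numFieldNormedType.Exports.
Local Open Scope classical_set_scope.
Local Open Scope ring_scope.

Definition Leb (R : realType) := @completed_lebesgue_measure R.

Section defs.
Variable R : realType.

Definition Lmeasurable (A : set R) : Prop :=
  exists B N : set R, measurable B /\ measurable N /\
    (@lebesgue_measure R N = 0)%E /\ B `<=` A /\ A `<=` B `|` N.

Definition Lmeasurable_fun (D : set R) (f : R -> R) : Prop :=
  forall B : set R, measurable B -> Lmeasurable (D `&` f @^-1` B).

Definition sqn (m : nat) (v : 'rV[R]_m) : R := \sum_(i < m) (v 0 i) ^+ 2.

Definition C1 (V W : normedModType R) (f : V -> W) : Prop :=
  (forall p, differentiable f p) /\ (forall w : V, continuous (fun p => 'D_w f p)).

Definition glob_lipschitz (V W : normedModType R) (f : V -> W) : Prop :=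
  exists L : R, forall p q, `|f p - f q| <= L * `|p - q|.

Definition Fapp (n m : nat) (F0 : 'rV[R]_n -> 'rV[R]_n -> 'rV[R]_n)
  (F1 : 'rV[R]_n -> 'rV[R]_n -> 'M[R]_(n, m)) (x v : 'rV[R]_n) (u : 'rV[R]_m)
  : 'rV[R]_n := F0 x v + (F1 x v *m u^T)^T.

Definition maxd (n : nat) (tau : R) (x : R -> 'rV[R]_n) (t : R) : 'rV[R]_n :=
  \row_i sup [set (x s) 0 i | s in `[t - tau, t]%classic].

Definition lie (n : nat) (tau k : R) (x : R -> 'rV[R]_n) (t : R) : 'rV[R]_n :=
  \row_i (k^-1 * ln (Rintegral (@Leb R) `[t - tau, t]%classic
                        (fun s => expR (k * (x s) 0 i)))).

Definition convex_in (m : nat) (U : set 'rV[R]_m) : Prop :=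
  forall a b, U a -> U b -> forall l : R, 0 <= l <= 1 ->
    U (l *: a + (1 - l) *: b).

(* normal integrand on [0,T] x R^(n+m): the epigraphical mapping
   t |-> epi j(t,.,.) is closed-valued and measurable *)
Definition epi (n m : nat) (j : R -> 'rV[R]_n -> 'rV[R]_m -> R) (t : R)
  : set (('rV[R]_n * 'rV[R]_m) * R) :=
  [set p | j t p.1.1 p.1.2 <= p.2].

Definition normal_integrand (n m : nat) (T : R)
  (j : R -> 'rV[R]_n -> 'rV[R]_m -> R) : Prop :=
  (forall t, `[0, T]%classic t -> closed (epi j t)) /\
  (forall O : set (('rV[R]_n * 'rV[R]_m) * R), open O ->
     Lmeasurable [set t | `[0, T]%classic t /\ exists p, O p /\ epi j t p]).

Definition j_assumptions (n m : nat) (T : R)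
  (j : R -> 'rV[R]_n -> 'rV[R]_m -> R) : Prop :=
  (forall t x u, 0 <= j t x u) /\
  normal_integrand T j /\
  (forall t x (u v : 'rV[R]_m) (l : R), 0 <= l <= 1 ->
     j t x (l *: u + (1 - l) *: v) <= l * j t x u + (1 - l) * j t x v) /\
  (forall t u x, differentiable (fun y => j t y u) x) /\
  (forall t (w : 'rV[R]_n),
     continuous (fun p : 'rV[R]_n * 'rV[R]_m => 'D_w (fun y => j t y p.2) p.1)).

Definition feasible (m : nat) (T : R) (U : set 'rV[R]_m) (u : R -> 'rV[R]_m)
  : Prop :=
  (forall i : 'I_m, Lmeasurable_fun `[0, T]%classic (fun t => (u t) 0 i)) /\
  (exists M : R, {ae @Leb R, forall t, `[0, T]%classic t -> `|u t| <= M}) /\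
  {ae @Leb R, forall t, `[0, T]%classic t -> U (u t)}.

(* x in C([-tau,T]) cap W^{1,oo}(I), x' = F(x, delay x, u) a.e. on (0,T),
   x = phi on [-tau,0] *)
Definition solves (n m : nat) (tau T : R) (phi : R -> 'rV[R]_n)
  (delay : (R -> 'rV[R]_n) -> R -> 'rV[R]_n)
  (F0 : 'rV[R]_n -> 'rV[R]_n -> 'rV[R]_n)
  (F1 : 'rV[R]_n -> 'rV[R]_n -> 'M[R]_(n, m))
  (u : R -> 'rV[R]_m) (x : R -> 'rV[R]_n) : Prop :=
  {within `[- tau, T]%classic, continuous x} /\
  (exists L : R, forall s t, `[0, T]%classic s -> `[0, T]%classic t ->
      `|x s - x t| <= L * `|s - t|) /\
  {ae @Leb R, forall t, `]0, T[%classic t ->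
      is_derive t 1 x (Fapp F0 F1 (x t) (delay x t) (u t))} /\
  (forall s, `[- tau, 0]%classic s -> x s = phi s).

Definition Jcost (n m : nat) (T : R) (j : R -> 'rV[R]_n -> 'rV[R]_m -> R)
  (x : R -> 'rV[R]_n) (u : R -> 'rV[R]_m) : \bar R :=
  (\int[@Leb R]_(t in `[0%R, T]%classic) (j t (x t) (u t))%:E)%E.

Definition Jk_cost (n m : nat) (T : R) (j : R -> 'rV[R]_n -> 'rV[R]_m -> R)
  (us : R -> 'rV[R]_m) (x : R -> 'rV[R]_n) (u : R -> 'rV[R]_m) : \bar R :=
  (\int[@Leb R]_(t in `[0%R, T]%classic)
      (j t (x t) (u t) + 2^-1 * sqn (u t - us t))%:E)%E.

Definition L2ball (m : nat) (T delta : R) (us u : R -> 'rV[R]_m) : Prop :=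
  (\int[@Leb R]_(t in `[0%R, T]%classic) (sqn (u t - us t))%:E <= (delta ^+ 2)%:E)%E.

End defs.

(* Main.v *)
(* Direct method. A state is a fixed point of a Volterra operator, so a control determines its state
   (Picard iteration with an exponential weight), and the states of all admissible controls are
   equibounded and equi-Lipschitz. Along a minimizing sequence the states converge uniformly
   (Arzela-Ascoli). Instead of extracting a weak limit of the controls u_k, take the convex
   combinations of minimal L^2 norm of the tails (u_k)_{k >= p}: by the parallelogram law they are
   Cauchy in L^2, and a fast subsequence converges a.e. to a U-valued control. Since the dynamics is
   affine in the control and the states converge uniformly, the limit control generates the limit
   state. Since the integrand is convex in the control, is lower semicontinuous, and depends on the
   state uniformly over the compact set U, Fatou's lemma along the convex combinations gives lower
   semicontinuity of the cost. *)

Require Import Defs.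
From HB Require Import structures.
From mathcomp Require Import all_boot all_order all_algebra.
From mathcomp Require Import all_classical all_reals all_analysis measurable_realfun.
From mathcomp Require Import ring lra.
Set Implicit Arguments. Unset Strict Implicit. Unset Printing Implicit Defensive.
Import Order.TTheory GRing.Theory Num.Theory.
Import numFieldNormedType.Exports.
Local Open Scope classical_set_scope.
Local Open Scope ring_scope.

(* R with the completed sigma-algebra on which Leb is defined. *)
Notation LT R := (caratheodory_type (R:=R) (T:=lebesgue_stieltjes_measure_ocitv_type__canonical__measurable_structure_SemiRingOfSets R) (wlength idfun)^*%mu).

(** Controls are given almost everywhere on [0, T] and measurable for the completed sigma-algebra,
    whereas contraction and compactness arguments want pointwise bounds at all times. Hence two
    normalizations: a control is replaced by a representative with values in [U] on the whole real
    line, and a state is extended to a bounded continuous function on the line by clamping time. The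
    minimization is carried out for such pairs and transferred back at the end.

    The delay LogIntExp is monotone and commutes with adding constants, so it is nonexpansive for
    the sup norm on the window, with constant 1 whatever [k]. It therefore behaves like a point
    evaluation, both in the contraction and in uniform limits.

    One family of weights has to serve three limits: the state equation, the cost and the L^2 ball.
    It is chosen from the controls alone, and it still works for F1(x_k, .) u_k and j(t, x_k, u_k)
    because the weights of index p live on k >= p, where the states are already uniformly close to
    their limit. The integrand has no upper bound, so costs take values in [0, +oo] and only
    one-sided estimates of them are available. *)

Lemma measurable_fun_if_set d (T : measurableType d) (R : realType) (A : set T)
  (f g : T -> R) : measurable A -> measurable_fun A f -> measurable_fun setT g ->
  measurable_fun setT (fun t => if t \in A then f t else g t).
Proof.
move=> mA mf mg.
have A1 : (fun t : T => t \in A) @^-1` [set true] = A.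
  by apply/seteqP; split => t /=; [exact: set_mem|exact: mem_set].
apply: measurable_fun_if => //.
- by apply: (@measurable_fun_bool _ _ _ _ true); rewrite A1; exact: measurableI.
- by rewrite A1 setTI.
- exact: measurable_funTS.
Qed.

(** * Lebesgue measurability *)

Section leb.
Variable R : realType.
Implicit Types (A B D : set R) (f g : R -> R).

Definition Lmf f := measurable_fun setT (f : LT R -> R).

Lemma borel_Leb A : measurable A -> measurable (A : set (LT R)).
Proof. exact: sub_caratheodory. Qed.

(** Completeness of [Leb] gives one direction; the other holds because the Caratheodory sets are
    exactly the completion of the Borel sets by null sets. *)
Lemma LmeasurableP A : Lmeasurable A <-> measurable (A : set (LT R)).
Proof.
split.
  move=> [B [N [mB [mN [N0 [BA ABN]]]]]].
  have -> : A = B `|` (A `&` N).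
    apply/seteqP; split => [x Ax|x [/BA//|[]//]].
    by have [|Nx] := ABN _ Ax; [left|right].
  apply: measurableU; first exact: borel_Leb.
  apply: completed_lebesgue_measure_is_complete.
  by exists N; split; [exact: borel_Leb|exact: N0|move=> x []].
move=> mA; suff : completed_algebra_gen (@lebesgue_measure R) A.
  move=> -[B mB [N [N' [mN' N'0 NN']]] <-]; exists B, N'; do 4 split => //.
  by move=> x [|/NN']; [left|right].
by rewrite -g_sigma_completed_algebra_genE completed_caratheodory_measurable.
Qed.

Lemma Lmf_borel f : measurable_fun setT f -> Lmf f.
Proof. by move=> mf _ B mB; apply: borel_Leb; apply: mf. Qed.

Lemma Lmf_continuous f : continuous f -> Lmf f.
Proof. by move=> /continuous_measurable_fun; exact: Lmf_borel. Qed.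

Lemma Lmeasurable_funE D f : measurable D -> Lmeasurable_fun D f <->
  measurable_fun (D : set (LT R)) (f : LT R -> R).
Proof.
move=> mD; split=> [mf _ B /mf /LmeasurableP//|mf B mB].
by apply/LmeasurableP; apply: mf => //; exact: borel_Leb.
Qed.

Lemma ae_Leb (P : R -> Prop) :
  {ae @lebesgue_measure R, forall t, P t} -> {ae @Leb R, forall t, P t}.
Proof. by move=> [N [mN N0 PN]]; exists N; split => //; exact: borel_Leb. Qed.

(** For each rational q the set {f > q} lies between Borel sets B_q and B_q [|] N_q with N_q null.
    Off the union N of the N_q the B_q determine [f], so setting [f] to 0 on N gives a Borel
    function. This opens the way to theorems stated for [lebesgue_measure]. *)
Lemma Lmf_ex_borel f : Lmf f ->
  exists2 g, measurable_fun setT g & {ae @Leb R, forall t, f t = g t}.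
Proof.
move=> mf.
have H (q : rat) : exists BN : set R * set R, [/\ measurable BN.1, measurable BN.2,
    @lebesgue_measure R BN.2 = 0%E, BN.1 `<=` [set t | f t > ratr q] &
    [set t | f t > ratr q] `<=` BN.1 `|` BN.2].
  have : measurable ([set t | f t > ratr q] : set (LT R)).
    rewrite -[X in measurable X]setTI -(preimage_itvoy f).
    by apply: mf => //; exact: measurable_itv.
  move=> /LmeasurableP[B [N [? [? [? [? ?]]]]]].
  by exists (B, N); split.
have [BN BNP] := choice H.
pose N := \bigcup_(q : rat) (BN q).2.
have mN : measurable N by apply: bigcupT_measurable_rat => q; have [] := BNP q.
have N0 : @lebesgue_measure R N = 0%E.
  have /ppcard_eqP[e] := card_rat.
  have [M [mM M0 NM]] : (@lebesgue_measure R).-negligible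
      (\bigcup_n (BN (e^-1%FUN n)).2).
    apply: negligible_bigcup => n.
    by have [_ mq q0 _ _] := BNP (e^-1%FUN n); apply/negligibleP.
  apply/negligibleP => //; exists M; split => //.
  move=> t [q _ qt]; apply: NM.
  by exists (e q) => //; rewrite funK ?inE.
pose g t := if t \in N then 0 else f t.
exists g; last first.
  exists N; split; [exact: borel_Leb|exact: N0|].
  by move=> t /=; rewrite /g; case: ifPn => [/set_mem//|].
apply: (measurability _ (measurable_realfun.RGenOInfty.measurableE R)).
move=> _ [_ [x ->]] <-; rewrite setTI preimage_itvoy.
(* Off N, {g > x} is the union of the B_q over rational q >= x; N itself belongs to {g > x} exactly
   when x < 0, as [g] vanishes there. *)
rewrite [X in measurable X](_ : _ = ((if 0 > x then N else set0) `|`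
   (\bigcup_(q : rat) (if x <= ratr q then (BN q).1 else set0)) `\` N)).
  apply: measurableU; first by case: ifP.
  apply: measurableD => //; apply: bigcupT_measurable_rat => q.
  by case: ifP => // _; have [] := BNP q.
apply/seteqP; split => t; rewrite /g /=.
  case: ifPn => [/set_mem Nt x0|/negP tN xft]; first by left; rewrite x0.
  right; split; last by move=> Nt; apply: tN; rewrite inE.
  have [q /andP[xq qf]] := rat_in_itvoo xft.
  exists q => //; rewrite ltW//; have [_ _ _ _ /(_ t qf) [//|Nt]] := BNP q.
  by exfalso; apply: tN; rewrite inE; exists q.
case=> [|[[q _]]].
  by case: ifPn => // x0 /mem_set ->.
case: (boolP (x <= ratr q)) => // xq Bt Nt; rewrite memNset//.
by have [_ _ _ /(_ t Bt) /= qf _] := BNP q; exact: le_lt_trans qf.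
Qed.

(** The identity is measurable from the completed to the Borel structure, and [lebesgue_measure] is
    the image of [Leb] under it; the claim is change of variables. *)
Lemma Rintegral_Leb D f : measurable D -> measurable_fun setT f ->
  (@Leb R).-integrable (D : set (LT R)) (EFin \o f) ->
  (@lebesgue_measure R).-integrable D (EFin \o f) /\
  \int[@Leb R]_(t in D) (f t) = \int[@lebesgue_measure R]_(t in D) (f t).
Proof.
move=> mD mf intf.
have mid : measurable_fun [set: LT R] (idfun : LT R -> measurableTypeR R).
  by move=> _ B mB; rewrite setTI; exact: borel_Leb.
pose nu := (pushforward (@Leb R) (idfun : LT R -> measurableTypeR R)).
have E (h : R -> \bar R) : (\int[@lebesgue_measure R]_(t in D) h t = \int[nu]_(t in D) h t)%E.
  exact: eq_measure_integral.
split.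
  apply/integrableP; split; first by apply/measurable_EFinP; exact: measurable_funTS.
  rewrite E ge0_integral_pushforward//.
    by have /integrableP[] := intf.
  by apply: measurableT_comp => //; apply/measurable_EFinP; exact: measurable_funTS.
rewrite /Rintegral; congr fine; rewrite E integral_pushforward//.
exact/measurable_EFinP.
Qed.

End leb.

Notation "'I[' a , b ] f" := (\int[@Leb _]_(s in `[a, b]%classic) (f s))
  (at level 10, f at level 9, format "'I[' a ,  b ]  f") : ring_scope.
Notation "'aeL' t , P" := {ae (@Leb _), forall t, P}
  (at level 200, t name, P at level 200) : type_scope.

Section measurable_closure.
Variable R : realType.
Implicit Types (f g : R -> R).

Lemma Lmf_cst (k : R) : Lmf (fun=> k).
Proof. exact: measurable_cst. Qed.

Lemma LmfD f g : Lmf f -> Lmf g -> Lmf (fun t => f t + g t).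
Proof. exact: measurable_funD. Qed.

Lemma LmfB f g : Lmf f -> Lmf g -> Lmf (fun t => f t - g t).
Proof. exact: measurable_funB. Qed.

Lemma LmfM f g : Lmf f -> Lmf g -> Lmf (fun t => f t * g t).
Proof. exact: measurable_funM. Qed.

Lemma Lmf_sum (I : Type) (r : seq I) (F : I -> R -> R) :
  (forall i, Lmf (F i)) -> Lmf (fun t => \sum_(i <- r) F i t).
Proof. by move=> mF; apply: measurable_sum => i; exact: mF. Qed.

Lemma aeLS (P Q : R -> Prop) : (forall t, P t -> Q t) -> (aeL t, P t) -> aeL t, Q t.
Proof.
move=> PQ; apply: filterS; first exact: (ae_filter_ringOfSetsType (@Leb R)).
exact: PQ.
Qed.

Lemma aeLI (P Q : R -> Prop) : (aeL t, P t) -> (aeL t, Q t) -> aeL t, P t /\ Q t.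
Proof.
by move=> aP aQ; apply: filterI => //; exact: (ae_filter_ringOfSetsType (@Leb R)).
Qed.

Lemma aeL_forall (P : nat -> R -> Prop) : (forall n, aeL t, P n t) -> aeL t, forall n, P n t.
Proof. by move=> aP; apply/ae_foralln. Qed.

Lemma aeL_neq (a : R) : aeL t, t != a.
Proof.
exists [set a]; split; first by apply: borel_Leb; exact: measurable_set1.
  exact: (lebesgue_measure_set1 a).
by move=> t /=; apply: contra_notP => /eqP.
Qed.

End measurable_closure.

Lemma Rintegral_null d (T : measurableType d) (R : realType)
    (mu : {measure set T -> \bar R}) (N : set T) (f : T -> R) :
  measurable N -> measurable_fun N f -> mu N = 0%E -> \int[mu]_(t in N) f t = 0.
Proof.
move=> mN mf N0; rewrite /Rintegral null_set_integral//.
exact/measurable_EFinP.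
Qed.

(** * Retraction of the line onto a compact interval *)

Section clamp.
Variable R : realType.
Implicit Types a b s t : R.

(** Composing with this retraction onto [a, b] extends a function from [a, b] to the line and
    preserves continuity, bounds and Lipschitz constants. *)
Definition clamp a b t := Num.max a (Num.min b t).

Lemma clamp_bound a b t : a <= b -> a <= clamp a b t <= b.
Proof. by move=> ab; rewrite /clamp le_max lexx /= ge_max ab ge_min lexx. Qed.

Lemma clamp_id a b t : a <= t <= b -> clamp a b t = t.
Proof. by move=> /andP[t0 tT]; rewrite /clamp min_r// max_r. Qed.

Lemma clamp_homo a b s t : s <= t -> clamp a b s <= clamp a b t.
Proof.
move=> st; rewrite /clamp ge_max le_max lexx /= le_max; apply/orP; right.
by rewrite le_min !ge_min lexx st orbT.
Qed.

Lemma max_lipschitz a s t : `|Num.max a s - Num.max a t| <= `|s - t|.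
Proof.
wlog st : s t / s <= t.
  by move=> H; case: (leP s t) => [/H//|/ltW/H]; rewrite distrC (distrC t).
rewrite distrC (distrC s) (ger0_norm (x := t - s)) ?subr_ge0//.
by case: (leP a s) => sa; case: (leP a t) => ta; rewrite ger0_norm; lra.
Qed.

Lemma min_lipschitz a s t : `|Num.min a s - Num.min a t| <= `|s - t|.
Proof.
wlog st : s t / s <= t.
  by move=> H; case: (leP s t) => [/H//|/ltW/H]; rewrite distrC (distrC t).
rewrite distrC (distrC s) (ger0_norm (x := t - s)) ?subr_ge0//.
by case: (leP a s) => sa; case: (leP a t) => ta; rewrite ger0_norm; lra.
Qed.

Lemma clamp_lipschitz a b s t : `|clamp a b s - clamp a b t| <= `|s - t|.
Proof. exact: le_trans (max_lipschitz _ _ _) (min_lipschitz _ _ _). Qed.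

Lemma lipschitz_continuous (V : normedModType R) (f : R -> V) (L : R) :
  (forall s t, `|f s - f t| <= L * `|s - t|) -> continuous f.
Proof.
move=> Lf t; have L0 : 0 <= L.
  have := le_trans (normr_ge0 _) (Lf 1 0).
  by rewrite subr0 normr1 mulr1.
apply/cvgrPdist_le => e e0.
(* Dividing by L + 1 keeps the radius meaningful when L = 0. *)
have : \forall s \near t, `|t - s| <= e / (L + 1).
  apply/nbhs_ballP; exists (e / (L + 1)) => /= [|s]; last exact: ltW.
  by rewrite divr_gt0// ltr_wpDl.
apply: filterS => s ts; apply: (le_trans (Lf _ _)).
rewrite (le_trans (ler_wpM2l L0 ts))// mulrCA ler_piMr ?ltW//.
by rewrite ltr_pdivrMr ?mul1r ?ltrDl// ltr_wpDl.
Qed.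

Lemma clamp_continuous a b : continuous (clamp a b).
Proof.
apply: (@lipschitz_continuous _ _ 1) => s t; rewrite mul1r.
exact: clamp_lipschitz.
Qed.

End clamp.

(** * Integrals of bounded measurable functions over intervals *)

Section interval_integral.
Variable R : realType.
Implicit Types (f g : R -> R) (M a b c t : R).

(** The bound is imposed on the whole line, so that integrability over every compact interval
    follows without side conditions. *)
Definition bmf M f := Lmf f /\ forall t, `|f t| <= M.

Lemma measurable_itv_Leb (i : interval R) : measurable ([set` i] : set (LT R)).
Proof. by apply: borel_Leb; exact: measurable_itv. Qed.

Lemma Leb_itv a b : a <= b -> @Leb R `[a, b]%classic = (b - a)%:E.
Proof.
move=> ab; rewrite [LHS](lebesgue_measure_itv `[a, b]) /= lte_fin.
by case: ltgtP ab => // -> _; rewrite subrr.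
Qed.

Lemma Leb_itv_lty a b : (@Leb R `[a, b]%classic < +oo)%E.
Proof.
by rewrite [X in (X < _)%E](lebesgue_measure_itv `[a, b]) /=; case: ifP; rewrite // -EFinB ltry.
Qed.

Lemma bounded_itv_integrable M f a b : Lmf f -> (forall t, a <= t <= b -> `|f t| <= M) ->
  (@Leb R).-integrable (`[a, b]%classic : set (LT R)) (EFin \o f).
Proof.
move=> mf bf; apply: measurable_bounded_integrable.
- exact: measurable_itv_Leb.
- exact: Leb_itv_lty.
- exact: measurable_funTS.
- exists M; split; first exact: num_real.
  by move=> B MB t /=; rewrite in_itv /= => /bf tM; apply: (le_trans tM); exact: ltW.
Qed.

Lemma bmf_integrable M f a b : bmf M f ->
  (@Leb R).-integrable (`[a, b]%classic : set (LT R)) (EFin \o f).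
Proof. by move=> [mf bf]; apply: (@bounded_itv_integrable M). Qed.

Lemma int_le M f a b : a <= b -> Lmf f -> (forall t, a <= t <= b -> `|f t| <= M) ->
  `|I[a, b] f| <= M * (b - a).
Proof.
move=> ab mf bf.
have M0 : 0 <= M by apply: le_trans (bf a _); rewrite ?normr_ge0// lexx.
have mab := measurable_itv_Leb `[a, b].
have intf := bounded_itv_integrable mf bf.
have E : \int[@Leb R]_(s in `[a, b]%classic) M = M * (b - a).
  by rewrite Rintegral_cst// [X in fine X](Leb_itv ab).
rewrite -E; apply: (le_trans (le_normr_Rintegral mab intf)).
apply: le_Rintegral => //.
- exact: integrable_norm.
- by apply: (@bmf_integrable M); split; [exact: Lmf_cst|move=> t; rewrite ger0_norm].
Qed.

(** The two closed intervals overlap at b, which is split off as a null set. *)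
Lemma int_add M f a b c : a <= b -> b <= c -> bmf M f ->
  I[a, c] f = I[a, b] f + I[b, c] f.
Proof.
move=> ab bc bf.
pose J (A : set R) := \int[@Leb R]_(s in A) f s.
have addJ (A B C : set R) x y : measurable A -> measurable B -> A `|` B = C ->
    C = `[x, y]%classic -> A `&` B = set0 -> J C = J A + J B.
  move=> mA mB <- Cxy AB; rewrite /J Rintegral_setU//.
  - exact: borel_Leb.
  - exact: borel_Leb.
  - by rewrite Cxy; exact: bmf_integrable bf.
  - by rewrite disj_set2E AB.
have J1 x : J [set x] = 0.
  apply: (@Rintegral_null _ (LT R)); first by apply: borel_Leb; exact: measurable_set1.
    by apply: measurable_funTS; exact: bf.1.
  exact: (lebesgue_measure_set1 x).
have Jbc : J `[b, c]%classic = J `]b, c]%classic.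
  rewrite (addJ [set b] `]b, c]%classic _ b c) ?J1 ?add0r//.
    by apply: setU1itv; rewrite bnd_simp.
  by apply/seteqP; split => // t /= [->]; rewrite in_itv /= ltxx.
rewrite -[LHS]/(J _) -[RHS]/(J _ + J _) Jbc; apply: (addJ _ _ _ a c) => //.
  apply/seteqP; split => t /=; rewrite !in_itv /=.
    move=> [/andP[-> tb]|/andP[bt ->]]; first exact: le_trans tb bc.
    by rewrite andbT (le_trans ab)// ltW.
  by case: (leP t b) => tb /andP[-> ->]; [left|right].
apply/seteqP; split => // t /=; rewrite !in_itv /= => -[/andP[_ tb] /andP[bt _]].
by move: (le_lt_trans tb bt); rewrite ltxx.
Qed.

Lemma int_lin M N f g (k : R) a b : bmf M f -> bmf N g ->
  I[a, b] (fun s => k * f s + g s) = k * I[a, b] f + I[a, b] g.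
Proof.
move=> bf bg; rewrite RintegralD//.
- by rewrite RintegralZl//; [exact: measurable_itv_Leb|exact: bmf_integrable bf].
- exact: measurable_itv_Leb.
- apply: (@bmf_integrable (`|k| * M)); split.
    by apply: LmfM; [exact: Lmf_cst|exact: bf.1].
  by move=> t; rewrite normrM ler_wpM2l// bf.2.
- exact: bmf_integrable bg.
Qed.

Lemma int_ae_eq f g a b : Lmf f -> Lmf g ->
  (aeL t, a <= t <= b -> f t = g t) -> I[a, b] f = I[a, b] g.
Proof.
move=> mf mg fg; congr fine; apply: ae_eq_integral.
- exact: measurable_itv_Leb.
- by apply/measurable_EFinP; exact: measurable_funTS.
- by apply/measurable_EFinP; exact: measurable_funTS.
- by apply: aeLS fg => t /= + tab; rewrite in_itv /= in tab; move=> /(_ tab) ->.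
Qed.

Lemma int_cvg M (f_ : nat -> R -> R) f a b : (forall n, bmf M (f_ n)) -> Lmf f ->
  (aeL t, a <= t <= b -> (f_ n t) @[n --> \oo] --> f t) ->
  (I[a, b] (f_ n)) @[n --> \oo] --> I[a, b] f.
Proof.
move=> bf mf ff.
have mab := measurable_itv_Leb `[a, b].
have M0 : 0 <= M by apply: le_trans ((bf 0%N).2 0); rewrite normr_ge0.
have [] := @dominated_convergence _ (LT R) R (@Leb R) `[a, b]%classic
  mab (fun n t => (f_ n t)%:E) (EFin \o f) (cst M%:E).
- by move=> n; apply/measurable_EFinP; apply: measurable_funTS; exact: (bf n).1.
- by apply/measurable_EFinP; exact: measurable_funTS.
- apply: aeLS ff => t /= + tab; rewrite in_itv /= in tab => /(_ tab) ft.
  by apply/fine_cvgP; split; [exact: nearW|exact: ft].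
- by apply: (@bmf_integrable M (cst M)); split; [exact: Lmf_cst|move=> t; rewrite ger0_norm].
- by apply: aeW => t n _ /=; rewrite lee_fin (bf n).2.
move=> intf _ H; apply: fine_cvg => /=.
suff -> : (fine (\int[@Leb R]_(t in `[a, b]%classic) (f t)%:E))%:E =
   (\int[@Leb R]_(t in `[a, b]%classic) (f t)%:E)%E by exact: H.
by rewrite fineK//; apply: integrable_fin_num.
Qed.

Lemma int_lt0 f a b : b < a -> I[a, b] f = 0.
Proof. by move=> ba; rewrite set_itv_ge ?Rintegral_set0// bnd_simp -ltNge. Qed.

(* The primitive is 0 on the negative axis, where [0, t] is empty. *)
Lemma primitive_lipschitz M f s t : bmf M f -> `|I[0, s] f - I[0, t] f| <= M * `|s - t|.
Proof.
move=> bf; have M0 : 0 <= M by apply: le_trans (bf.2 0); rewrite normr_ge0.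
wlog st : s t / s <= t.
  by move=> H; case: (leP s t) => [/H//|/ltW/H]; rewrite distrC (distrC t).
rewrite distrC (distrC s) (ger0_norm (x := t - s)) ?subr_ge0//.
case: (ltP s 0) => s0.
  rewrite (int_lt0 _ s0) subr0; case: (ltP t 0) => t0.
    by rewrite (int_lt0 _ t0) normr0 mulr_ge0// subr_ge0.
  apply: (le_trans (int_le t0 bf.1 (fun x _ => bf.2 x))).
  by rewrite ler_wpM2l// lerD2l lerN2 ltW.
rewrite (int_add s0 st bf) addrAC subrr add0r.
by apply: int_le => // [|x _]; [exact: bf.1|exact: bf.2].
Qed.

End interval_integral.

(** * The fundamental theorem of calculus for bounded measurable functions *)

Section FTC.
Variable R : realType.

Lemma derive_seq (f : R -> R) (t l : R) : is_derive t 1 f l ->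
  (n.+1%:R * (f (t + n.+1%:R^-1) - f t)) @[n --> \oo] --> l.
Proof.
move=> [df <-]; have /cvgr_dnbhsP/(_ (fun n => n.+1%:R^-1)) := df.
set F := (X in _ -> X @ _ --> _) => H.
suff : F @ \oo --> 'D_1 f t.
  suff -> : F = (fun n => n.+1%:R * (f (t + n.+1%:R^-1) - f t)) by [].
  by apply/funext => n; rewrite /F /= invrK [_%:A]mulr1; congr (_ * (f _ - _)); rewrite addrC.
by apply: H; split; [move=> n; rewrite invr_eq0 pnatr_eq0|exact: cvg_harmonic].
Qed.

Implicit Types (f g : R -> R) (M a b c t : R).

Lemma bounded_locally_integrable f M : measurable_fun setT f -> (forall t, `|f t| <= M) ->
  locally_integrable setT f.
Proof.
move=> mf bf; split => //; first exact: openT.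
move=> K _ cK.
have mK := compact_measurable cK.
have : (@lebesgue_measure R).-integrable K (EFin \o f).
  apply: measurable_bounded_integrable => //.
  - exact: compact_finite_measure.
  - exact: measurable_funTS.
  - exists M; split; first exact: num_real.
    by move=> B MB t _; apply: (le_trans (bf t)); exact: ltW.
by move=> /integrableP[].
Qed.

(** [f] agrees almost everywhere with a Borel function, truncated to [-M, M] so that it stays
    bounded at every point. Both have the same primitive, to which Lebesgue differentiation
    applies. *)
Lemma FTC1_ae M f : bmf M f ->
  {ae @Leb R, forall t : R, 0 < t -> is_derive t 1 (fun u : R => I[0, u] f : R) (f t)}.
Proof.
move=> bf; have M0 : 0 <= M by apply: le_trans (bf.2 0); rewrite normr_ge0.
have [g mg fg] := Lmf_ex_borel bf.1.
pose h t := Num.max (- M) (Num.min M (g t)).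
have mh : measurable_fun setT h.
  by apply: measurable_maxr; [exact: measurable_cst|apply: measurable_minr => //; exact: measurable_cst].
have hM t : `|h t| <= M.
  by rewrite ler_norml /h le_max lexx /= ge_max ge_min lexx/= andbT ge0_cp.
have bh : bmf M h by split => //; exact: Lmf_borel.
have fh : aeL t, f t = h t.
  apply: aeLS fg => t; rewrite /h => <-; have := bf.2 t; rewrite ler_norml => /andP[? ?].
  by rewrite min_r// max_r.
have E : (fun u => I[0, u] f) = (fun u => \int[@lebesgue_measure R]_(t in `[0, u]) (h t)).
  apply/funext => u; have -> : I[0, u] f = I[0, u] h.
    by apply: int_ae_eq bf.1 bh.1 _; apply: aeLS fh => t ->.
  apply: (Rintegral_Leb _ mh _).2; first exact: measurable_itv.
  exact: bmf_integrable bh.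
have intl y : (@lebesgue_measure R).-integrable `[0, y] (EFin \o h).
  apply: (Rintegral_Leb _ mh _).1; first exact: measurable_itv.
  exact: bmf_integrable bh.
have := FTC1 intl (bounded_locally_integrable mh hM); move=> /= /ae_Leb H.
apply: aeLS (aeLI fh H) => t [ft H1] t0.
have [|d1 d2] := H1; first by rewrite lte_fin.
by rewrite ft E -d2 derive1E; exact: derivableP.
Qed.

(** The difference quotients h_n of step 1/q, q = n + 1, are bounded by the Lipschitz constant and
    tend to [g] almost everywhere, so their integrals over [0, t] tend to that of [g]. The same
    integrals telescope to the mean of [x] over [t, t + 1/q] minus its mean over [0, 1/q], which
    tends to x t - x 0 by continuity. *)
Lemma FTC2_lipschitz (x g : R -> R) (L M T : R) : 0 < T ->
  (forall s t : R, 0 <= s <= T -> 0 <= t <= T -> `|x s - x t| <= L * `|s - t|) ->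
  bmf M g -> {ae @Leb R, forall t : R, 0 < t < T -> is_derive t 1 x (g t)} ->
  forall t, 0 <= t <= T -> x t - x 0 = I[0, t] g.
Proof.
move=> T0 Lx bg dx.
(* The quotients look beyond T when s is close to T, so [x] is extended by a constant. *)
pose cl := clamp 0 T.
have clT t : 0 <= cl t <= T by apply: clamp_bound; exact: ltW.
have clE t : 0 <= t <= T -> cl t = t by exact: clamp_id.
have L0 : 0 <= L.
  have := Lx 0 T; rewrite !lexx (ltW T0) /= => /(_ isT isT).
  rewrite sub0r normrN (gtr0_norm T0) => /(le_trans (normr_ge0 _)).
  by rewrite pmulr_lge0.
pose y (t : R) : R := x (cl t).
have Ly s t : `|y s - y t| <= L * `|s - t|.
  by apply: (le_trans (Lx _ _ (clT s) (clT t))); rewrite ler_wpM2l// clamp_lipschitz.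
have cy : continuous y by exact: lipschitz_continuous Ly.
pose B : R := `|x 0| + L * T.
have yB t : `|y t| <= B.
  have -> : y t = x 0 + (y t - y 0) by rewrite /y (clE 0) ?lexx ?(ltW T0)// addrC subrK.
  apply: (le_trans (ler_normD _ _)); rewrite lerD2l.
  have := Lx (cl t) (cl 0) (clT _) (clT _) => /le_trans; apply.
  rewrite ler_wpM2l// (clE 0) ?lexx ?(ltW T0)// subr0.
  by have /andP[c0 cT] := clT t; rewrite ger0_norm.
have my : measurable_fun setT y by exact: continuous_measurable_fun.
have ylint a b : (@lebesgue_measure R).-integrable `[a, b] (EFin \o y).
  apply: (Rintegral_Leb _ my _).1; first exact: measurable_itv.
  by apply: (@bmf_integrable _ B); split => //; exact: Lmf_borel.
(* Starting at -1 makes 0 an interior point, so that [Y] is differentiable there too. *)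
pose Y (u : R) : R := \int[@lebesgue_measure R]_(s in `[-1, u]) (y s).
have dY (u : R) : -1 < u -> is_derive u 1 Y (y u).
  move=> u1; have u2 : u < u + 1 by rewrite ltrDl.
  have [d1 d2] := continuous_FTC1_closed u2 (ylint _ _) u1 (cy u).
  by rewrite -d2 derive1E; exact: derivableP.
pose q n : R := n.+1%:R.
have q0 n : 0 < q n by rewrite ltr0n.
have qV0 n : 0 < (q n)^-1 by rewrite invr_gt0.
pose h n (s : R) : R := q n * (y (s + (q n)^-1) - y s).
have bh n : bmf L (h n).
  split.
    apply: LmfM; first exact: Lmf_cst.
    apply: LmfB; last exact: Lmf_borel.
    apply: Lmf_continuous => s.
    apply: continuous_comp; last exact: cy.
    by apply: cvgD; [exact: cvg_id|exact: cvg_cst].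
  move=> s; rewrite /h normrM gtr0_norm//.
  rewrite -ler_pdivlMl// mulrC; apply: (le_trans (Ly _ _)).
  by rewrite addrAC subrr add0r gtr0_norm.
have hg : aeL s, 0 < s < T -> (h n s) @[n --> \oo] --> g s.
  apply: aeLS dx => s dxs s0T; have /andP[s0 sT] := s0T; move/(_ s0T) : dxs => dxs.
  have Ts0 : 0 < T - s by rewrite subr_gt0.
  apply: cvg_trans (derive_seq dxs); apply: near_eq_cvg; near=> n.
  have sn : (q n)^-1 < T - s by near: n; apply: (near_infty_natSinv_lt (PosNum Ts0)).
  rewrite /h /y !clE//; first by rewrite !ltW.
  by rewrite addr_ge0 ?(ltW s0) ?(ltW (qV0 n))//= -lerBrDl ltW.
move=> t /andP[]; rewrite le_eqVlt => /predU1P[<- _|t0 tT].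
  rewrite subrr; apply/esym/eqP; rewrite -normr_le0.
  by have := int_le (lexx 0) bg.1 (fun x _ => bg.2 x); rewrite subrr mulr0.
have c1 : (I[0, t] (h n)) @[n --> \oo] --> I[0, t] g.
  apply: (@int_cvg _ L) => //; first exact: bg.1.
  apply: aeLS (aeLI hg (aeLI (aeL_neq 0) (aeL_neq T))) => s [hs [s0 sT]] /andP[s0' sT'].
  by apply: hs; rewrite !lt_neqAle s0' eq_sym s0 sT (le_trans sT').
have E n : I[0, t] (h n) = q n * (Y (t + (q n)^-1) - Y t) - q n * (Y (0 + (q n)^-1) - Y 0).
  (* [G] is an antiderivative of the continuous function [h n]; using it avoids a change of
     variables in the shifted integral. *)
  pose G (s : R) : R := q n * (Y (s + (q n)^-1) - Y s).
  have dG (s : R) : -1 < s -> is_derive s 1 G (h n s).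
    move=> s1; have sn : -1 < s + (q n)^-1 by rewrite ltr_wpDr// ltW.
    have d1 := dY _ s1.
    have d2 : is_derive s 1 (Y \o (fun s : R => s + (q n)^-1)) (y (s + (q n)^-1) * 1).
      apply: is_derive1_comp; first exact: dY.
      by apply: is_derive_eq; rewrite addr0.
    have d3 : is_derive s 1 (Y \o (fun s : R => s + (q n)^-1) - Y) (y (s + (q n)^-1) * 1 - y s).
      exact: is_deriveB.
    have d4 := is_deriveZ (q n) d3.
    by apply: (is_derive_eq d4); rewrite /h mulr1.
  have cG (s : R) : -1 < s -> {for s, continuous G}.
    by move=> /dG[ds _]; apply/differentiable_continuous/derivable1_diffP.
  have ch : continuous (h n).
    move=> s; apply: cvgM; first exact: cvg_cst.
    apply: cvgB; last exact: cy.
    apply: (@continuous_comp _ _ _ (fun s : R => s + (q n)^-1) y); last exact: cy.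
    by apply: cvgD; [exact: cvg_id|exact: cvg_cst].
  rewrite (Rintegral_Leb _ _ _).2; last 3 first.
  - exact: measurable_itv.
  - exact: continuous_measurable_fun.
  - exact: bmf_integrable (bh n).
  rewrite /Rintegral (@continuous_FTC2 _ _ G)//.
  - exact: continuous_subspaceT.
  - split.
    + move=> s; rewrite in_itv /= => /andP[s0 _].
      by have [] := dG s (lt_trans (ltrN10 R) s0).
    + apply: cvg_at_right_filter; apply: cG; exact: ltrN10.
    + apply: cvg_at_left_filter; apply: cG; exact: lt_trans (ltrN10 R) t0.
  - move=> s; rewrite in_itv /= => /andP[s0 _]; rewrite derive1E.
    by have [] := dG s (lt_trans (ltrN10 R) s0).
have c2 (u : R) : 0 <= u -> (q n * (Y (u + (q n)^-1) - Y u)) @[n --> \oo] --> y u.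
  by move=> u0; apply: derive_seq; apply: dY; apply: lt_le_trans u0; exact: ltrN10.
have c3 : (I[0, t] (h n)) @[n --> \oo] --> y t - y 0.
  under eq_fun do rewrite E.
  by apply: cvgB; apply: c2; [exact: ltW|exact: lexx].
have := cvg_unique (@Rhausdorff R) c1 c3.
by rewrite /y !clE ?lexx ?(ltW T0) ?(ltW t0)// => ->.
Unshelve. all: by end_near. Qed.
End FTC.

(** * Max norm and entrywise convergence of matrices *)

Section mx.
Variable R : realType.

Lemma mx_norm_le p q (A : 'M[R]_(p, q)) (B : R) : 0 <= B ->
  (forall i j, `|A i j| <= B) -> `|A| <= B.
Proof.
by move=> B0 AB; rewrite [leLHS]/Num.Def.normr/= mx_normrE (bigmax_le _ B0)// => i _.
Qed.

Lemma mx_norm_ge p q (A : 'M[R]_(p, q)) i j : `|A i j| <= `|A|.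
Proof.
rewrite [leRHS]/Num.Def.normr/= mx_normrE.
exact: (le_bigmax _ (fun ij : 'I_p * 'I_q => `|A ij.1 ij.2|) (i, j)).
Qed.

Lemma cvg_mxP (T : Type) (F : set_system T) p q (f : T -> 'M[R]_(p, q)) (A : 'M[R]_(p, q)) :
  Filter F -> (forall i j, (f t i j) @[t --> F] --> A i j) -> f @ F --> A.
Proof.
move=> FF fA; apply/cvgrPdist_le => e e0.
have : \forall t \near F, forall i j, `|A i j - f t i j| <= e.
  apply: filter_forall => i; apply: filter_forall => j.
  by have /cvgrPdist_le := fA i j; apply.
by apply: filterS => t H; apply: mx_norm_le (ltW e0) _ => i j; rewrite !mxE.
Qed.

Lemma continuous_row (T : topologicalType) n (f : T -> 'rV[R]_n) :
  continuous f <-> forall i, continuous (fun t => f t 0 i).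
Proof.
split=> [cf i t|cf t].
  apply: (@continuous_comp _ _ _ f (fun A : 'rV[R]_n => A 0 i)); first exact: cf.
  exact: coord_continuous.
by apply: cvg_mxP => i j; rewrite ord1; exact: cf.
Qed.

Lemma pair_norm (V W : normedModType R) (x : V) (y : W) (B : R) :
  `|x| <= B -> `|y| <= B -> `|(x, y)| <= B.
Proof. by move=> xB yB; rewrite prod_normE /= ge_max xB yB. Qed.

End mx.

(** * The LogIntExp operator *)

Section lie.
Variable R : realType.
Variables (n : nat) (tau k : R).
Hypotheses (tau0 : 0 < tau) (k0 : 0 < k).
Implicit Types (x y : R -> 'rV[R]_n).

(** Bounded continuous functions on the line: the space on which the delay and the Volterra operator
    act. *)
Definition cbd (V : normedModType R) (x : R -> V) :=
  continuous x /\ exists M, forall t, `|x t| <= M.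

Lemma cbd_bmf (f : R -> R) : cbd f -> exists M, bmf M f.
Proof. by move=> [cf [M fM]]; exists M; split => //; exact: Lmf_continuous. Qed.

Lemma cbd_row x i : cbd x -> cbd (fun t => x t 0 i).
Proof.
move=> [cx [M xM]]; split; first exact: (continuous_row _).1.
by exists M => t; exact: le_trans (mx_norm_ge _ _ _) (xM t).
Qed.

Lemma cbd_exp (f : R -> R) : cbd f -> cbd (fun t => expR (k * f t)).
Proof.
move=> [cf [M fM]]; split.
  move=> t; apply: continuous_comp; last exact: continuous_expR.
  by apply: cvgM; [exact: cvg_cst|exact: cf].
exists (expR (k * M)) => t; rewrite ger0_norm ?expR_ge0// ler_expR ler_pM2l//.
by have := fM t; rewrite ler_norml => /andP[].
Qed.

Definition sumexp (f : R -> R) (t : R) : R := I[t - tau, t] (fun s => expR (k * f s)).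

Lemma le_tau t : t - tau <= t.
Proof. by rewrite lerBlDr lerDl ltW. Qed.

(** A shift of the exponent by B is a factor e^(k B); after the logarithm and division by k it
    becomes the additive constant B again. *)
Lemma sumexp_le (f g : R -> R) (B t : R) : cbd f -> cbd g ->
  (forall s, t - tau <= s <= t -> f s <= g s + B) ->
  sumexp f t <= expR (k * B) * sumexp g t.
Proof.
move=> cf cg fg.
have [M bf] := cbd_bmf (cbd_exp cf); have [N bg] := cbd_bmf (cbd_exp cg).
have mi := @measurable_itv_Leb R `[t - tau, t].
rewrite -RintegralZl//; last exact: bmf_integrable bg.
apply: le_Rintegral => //.
- exact: bmf_integrable bf.
- apply: (@bounded_itv_integrable _ (expR (k * B) * N)).
    by apply: LmfM; [exact: Lmf_cst|exact: bg.1].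
  by move=> s _; rewrite normrM ger0_norm ?expR_ge0// ler_wpM2l ?expR_ge0// bg.2.
- move=> s; rewrite /= in_itv /= => /fg H.
  by rewrite -expRD ler_expR -mulrDr ler_pM2l// addrC.
Qed.

Lemma sumexp_cst (f : R -> R) t : (forall s, f s = 0) -> sumexp f t = tau.
Proof.
move=> f0; rewrite /sumexp (@eq_Rintegral _ _ _ _ _ (cst 1)); last first.
  by move=> s _; rewrite f0 mulr0 expR0.
rewrite Rintegral_cst; last exact: measurable_itv_Leb.
by rewrite mul1r [X in fine X](Leb_itv (le_tau t))/= opprB addrC subrK.
Qed.

(** Comparison with the zero function, whose integral is [tau], gives a positive lower bound; the
    logarithm is thus taken where it is continuous and monotone. *)
Lemma sumexp_gt0 (f : R -> R) t : cbd f -> 0 < sumexp f t.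
Proof.
move=> cf; have [_ [M fM]] := cf.
have c0 : cbd (fun=> 0 : R).
  by split; [exact: cst_continuous|exists 0 => s; rewrite normr0].
have H : sumexp (fun=> 0) t <= expR (k * M) * sumexp f t.
  apply: sumexp_le => // s _; rewrite -lerBlDr sub0r.
  by have := fM s; rewrite ler_norml => /andP[].
have E : sumexp (fun=> 0) t = tau by exact: sumexp_cst.
have := tau0; rewrite -[X in 0 < X]E => /lt_le_trans/(_ H).
by rewrite pmulr_rgt0 ?expR_gt0.
Qed.

Lemma ln_le_shift (a b c : R) : 0 < a -> 0 < b -> a <= expR c * b -> ln a <= c + ln b.
Proof.
move=> a0 b0 ab.
by rewrite -[c]expRK -lnM ?posrE ?expR_gt0// ler_ln ?posrE ?mulr_gt0 ?expR_gt0.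
Qed.

Lemma lieE x t i : lie tau k x t 0 i = k^-1 * ln (sumexp (fun s => x s 0 i) t).
Proof. by rewrite mxE. Qed.

Lemma lie_coord_le x y (B t : R) i : cbd x -> cbd y ->
  (forall s, t - tau <= s <= t -> `|x s - y s| <= B) ->
  lie tau k x t 0 i <= lie tau k y t 0 i + B.
Proof.
move=> cx cy xy; have cxi := cbd_row i cx; have cyi := cbd_row i cy.
have H : sumexp (fun s => x s 0 i) t <= expR (k * B) * sumexp (fun s => y s 0 i) t.
  apply: sumexp_le => // s /xy; have := mx_norm_ge (x s - y s) 0 i.
  move=> /le_trans/[apply]; rewrite !mxE ler_norml => /andP[_].
  by rewrite lerBlDr addrC.
have A0 := sumexp_gt0 t cxi; have B0 := sumexp_gt0 t cyi.
have L := ln_le_shift A0 B0 H.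
rewrite (lieE x t i) (lieE y t i).
have kV0 : 0 <= k^-1 by rewrite invr_ge0 ltW.
have := ler_wpM2l kV0 L.
by rewrite mulrDr mulrA mulVf ?gt_eqF// mul1r addrC.
Qed.

(** From x <= y + B on the window follows lie x <= lie y + B, by monotonicity and invariance under
    constants; the symmetric inequality completes the bound, with constant 1 independent of [k] and
    [tau]. *)
Lemma lie_lipschitz x y (B t : R) : cbd x -> cbd y ->
  (forall s, t - tau <= s <= t -> `|x s - y s| <= B) ->
  `|lie tau k x t - lie tau k y t| <= B.
Proof.
move=> cx cy xy.
have B0 : 0 <= B by apply: le_trans (normr_ge0 _) (xy t _); rewrite le_tau lexx.
apply: mx_norm_le => // i j; rewrite ord1 [_ j]mxE [X in _ + X]mxE.
rewrite ler_norml lerBlDl lie_coord_le// andbT lerBrDr addrC lerBlDr.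
by apply: lie_coord_le => // s /xy; rewrite distrC.
Qed.

(** Moving the window from s to t drops [s - tau, t - tau] and adds [s, t], both of length t - s:
    hence the Lipschitz constant M + M. *)
Lemma sumexp_continuous (f : R -> R) : cbd f -> continuous (sumexp f).
Proof.
move=> cf; have [M bf] := cbd_bmf (cbd_exp cf).
set e := (fun s => expR (k * f s)) in bf.
apply: (@lipschitz_continuous _ _ _ (M + M)) => s t.
wlog st : s t / s <= t.
  by move=> H; case: (leP s t) => [/H//|/ltW/H]; rewrite distrC (distrC t).
have A1 := int_add (le_tau s) st bf.
have st' : s - tau <= t - tau by rewrite lerD2r.
have A2 := int_add st' (le_tau t) bf.
have -> : sumexp f s - sumexp f t = I[s - tau, t - tau] e - I[s, t] e.
  have aux (a b c d : R) : a + b = c + d -> c - b = a - d by move=> ?; lra.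
  by rewrite /sumexp; apply: aux; rewrite -A2.
apply: (le_trans (ler_normB _ _)); rewrite mulrDl distrC (ger0_norm (x := t - s)) ?subr_ge0//.
apply: lerD; last by apply: int_le => //; [exact: bf.1|move=> u _; exact: bf.2].
have := int_le st' bf.1 (fun u _ => bf.2 u).
by rewrite opprB addrA subrK.
Qed.

Lemma lie_cbd x : cbd x -> cbd (lie tau k x).
Proof.
move=> cx; split.
  apply/continuous_row => i t; under eq_fun do rewrite lieE.
  apply: cvgM; first exact: cvg_cst.
  apply: (@continuous_comp _ _ _ (sumexp (fun s => x s 0 i)) (@ln R)).
    by apply: sumexp_continuous; exact: cbd_row.
  by apply: continuous_ln; apply: sumexp_gt0; exact: cbd_row.
have [_ [M xM]] := cx.
have c0 : cbd (fun=> 0 : 'rV[R]_n).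
  by split; [exact: cst_continuous|exists 0 => s; rewrite normr0].
(* The image of zero is a constant function, which turns the nonexpansive bound into boundedness. *)
have E t : lie tau k (fun=> 0 : 'rV[R]_n) t = lie tau k (fun=> 0 : 'rV[R]_n) 0.
  by apply/rowP => i; rewrite !lieE !sumexp_cst// => s; rewrite mxE.
exists (M + `|lie tau k (fun=> 0 : 'rV[R]_n) 0|) => t.
have -> : lie tau k x t = (lie tau k x t - lie tau k (fun=> 0) t) + lie tau k (fun=> 0) t.
  by rewrite subrK.
apply: (le_trans (ler_normD _ _)); rewrite E lerD2r -(E t).
by apply: lie_lipschitz => // s _; rewrite subr0.
Qed.

End lie.

(** * Geometrically Cauchy sequences *)

Section geometric_limit.
Variable R : realType.

Lemma geometric_cauchy (a : nat -> R) (C : R) :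
  (forall p, `|a p.+1 - a p| <= C * (2^-1) ^+ p) ->
  exists l, forall p, `|a p - l| <= 2 * C * (2^-1) ^+ p.
Proof.
move=> aC.
have C0 : 0 <= C by have := le_trans (normr_ge0 _) (aC 0%N); rewrite expr0 mulr1.
have half0 (p : nat) : 0 <= (2^-1 : R) ^+ p by rewrite exprn_ge0.
have D p q : `|a (p + q)%N - a p| <= 2 * C * (2^-1) ^+ p - 2 * C * (2^-1) ^+ (p + q).
  elim: q => [|q IH]; first by rewrite addn0 !subrr normr0.
  rewrite addnS; apply: (le_trans (ler_distD (a (p + q)%N) _ _)).
  have := aC (p + q)%N; rewrite exprS; lra.
have D' p q : (p <= q)%N -> `|a q - a p| <= 2 * C * (2^-1) ^+ p.
  move=> pq; have := D p (q - p)%N; rewrite subnKC// => /le_trans; apply.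
  by rewrite gerBl mulr_ge0// mulr_ge0.
have cvgh : (2 * C * (2^-1 : R) ^+ p) @[p --> \oo] --> (0 : R).
  rewrite -(mulr0 (2 * C)); apply: cvgM; first exact: cvg_cst.
  by apply: cvg_expr; rewrite ger0_norm ?invr_ge0// invf_lt1// ltr1n.
have : cvgn a.
  apply/cauchy_cvgP/cauchy_ballP => e e0; rewrite near_map2.
  have e20 : 0 < e / 2 by rewrite divr_gt0.
  have /cvgrPdist_lt/(_ _ e20)[N _ /(_ N (leqnn N))] := cvgh.
  rewrite sub0r normrN => HN; have {}HN := le_lt_trans (ler_norm _) HN.
  exists ([set p | (N <= p)%N], [set p | (N <= p)%N]); first by split; exists N.
  move=> [p q] [/= Np Nq]; rewrite /ball /= (splitr e).
  apply: (le_lt_trans (ler_distD (a N) _ _)).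
  rewrite (distrC (a N)).
  exact: ltrD (le_lt_trans (D' _ _ Np) HN) (le_lt_trans (D' _ _ Nq) HN).
move=> /cvg_ex[l al]; exists l => p.
apply/ler_addgt0Pr => e e0.
have /cvgrPdist_le/(_ _ e0)[N _ HN] := al.
have := HN (maxn N p) (leq_maxl _ _); have := D' p (maxn N p) (leq_maxr _ _).
have := ler_distD (a (maxn N p)) (a p) l; rewrite (distrC l) (distrC (a p) (a _)); lra.
Qed.

End geometric_limit.

(** * Arzela-Ascoli for Lipschitz functions constant outside [0, T] *)

Section equicontinuous_compactness.
Variables (R : realType) (n : nat).
Variables (z : nat -> R -> 'rV[R]_n) (B M T : R).
Hypotheses (T0 : 0 < T) (M0 : 0 <= M).
Hypothesis zB : forall p t, `|z p t| <= B.
Hypothesis zM : forall p s t, `|z p s - z p t| <= M * `|s - t|.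
Hypothesis zT : forall p t, z p t = z p (clamp 0 T t).

Lemma closed_ball_rV_compact : compact [set v : 'rV[R]_n | `|v| <= B].
Proof.
have -> : [set v : 'rV[R]_n | `|v| <= B] =
    [set v : 'rV[R]_n | forall i, `[- B, B]%classic (v ord0 i)].
  apply/seteqP; split => v /= vB.
    by move=> i; rewrite in_itv /= -ler_norml; exact: le_trans (mx_norm_ge _ _ _) vB.
  have B0 : 0 <= B := le_trans (normr_ge0 _) (zB 0 0).
  by apply: mx_norm_le => // i j; rewrite ord1 ler_norml; have := vB j; rewrite in_itv.
by apply: (@rV_compact R n (fun=> `[- B, B]%classic)) => i; exact: segment_compact.
Qed.

(** Tychonoff's theorem yields a cluster point of the sequence for pointwise convergence. An
    uncountable product need not be sequentially compact, so no subsequence is claimed, only late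
    indices close to [zs] at finitely many prescribed points. *)
Lemma pointwise_cluster : exists zs : R -> 'rV[R]_n,
  forall (p r : nat) (e : R) (pt : 'I_r -> R), 0 < e ->
  exists2 q, (p <= q)%N & forall j, `|zs (pt j) - z q (pt j)| < e.
Proof.
have cA : compact ([set f | forall t, `|f t| <= B] : set (prod_topology (fun _ : R => 'rV[R]_n))).
  by apply: (@tychonoff R (fun=> 'rV[R]_n) (fun=> [set v | `|v| <= B])) => _; exact: closed_ball_rV_compact.
have [|zs [_ clz]] := cA ((z : nat -> prod_topology (fun _ : R => 'rV[R]_n)) @ \oo) _.
  by exists 0%N => // p _ t; exact: zB.
exists zs => p r e pt e0.
have HA : ((z : nat -> prod_topology (fun _ : R => 'rV[R]_n)) @ \oo)
    [set f | exists2 q, (p <= q)%N & f = z q].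
  by exists p => // q /= pq; exists q.
have HB : nbhs zs [set f : prod_topology (fun _ : R => 'rV[R]_n) |
    forall j, `|zs (pt j) - f (pt j)| < e].
  suff : \forall f \near nbhs (zs : prod_topology (fun _ : R => 'rV[R]_n)),
    forall j, `|zs (pt j) - f (pt j)| < e by [].
  apply: filter_forall => j.
  have cp : (f (pt j)) @[f --> (zs : prod_topology (fun _ : R => 'rV[R]_n))] --> zs (pt j).
    exact: (@proj_continuous R (fun=> 'rV[R]_n) (pt j) zs).
  move/cvgrPdist_lt : cp => H.
  have FF : Filter (nbhs (zs : prod_topology (fun _ : R => 'rV[R]_n))) by exact: nbhs_filter.
  have H' := H FF e e0.
  exact: H'.
have [_ [[q pq ->] H]] := clz _ _ HA HB.
by exists q.
Qed.

(** Closeness on a finite grid spreads to all times by the common Lipschitz constant. [sg] need not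
    be increasing: [p <= sg p] and the explicit rate 1/(p + 1) carry every later limit. *)
Lemma arzela_ascoli : exists (zs : R -> 'rV[R]_n) (sg : nat -> nat),
  [/\ forall p, (p <= sg p)%N,
      forall s t, `|zs s - zs t| <= M * `|s - t| &
      forall p t, `|zs t - z (sg p) t| <= p.+1%:R^-1 ].
Proof.
have [zs clz] := pointwise_cluster.
(* Agreement at two points is enough for [zs] to inherit the Lipschitz bound and the constancy
   outside [0, T]. *)
have two s t e : 0 < e -> exists q, `|zs s - z q s| < e /\ `|zs t - z q t| < e.
  move=> e0; have [q _ Hq] := clz 0%N 2 e (fun j => if j == ord0 then s else t) e0.
  by exists q; split; [exact: (Hq ord0)|exact: (Hq ord_max)].
have zsM s t : `|zs s - zs t| <= M * `|s - t|.
  apply/ler_addgt0Pr => e e0; have [q [qs qt]] := two s t (e / 2) (divr_gt0 e0 (ltr0Sn _ _)).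
  have -> : zs s - zs t = (zs s - z q s) + (z q s - z q t) - (zs t - z q t).
    by apply/rowP => i; rewrite !mxE; ring.
  apply: (le_trans (ler_normB _ _)); have := ler_normD (zs s - z q s) (z q s - z q t).
  have := zM q s t; lra.
have zsT t : zs t = zs (clamp 0 T t).
  apply/eqP; rewrite -subr_eq0 -normr_le0; apply/ler_addgt0Pr => e e0.
  have [q [qs qt]] := two t (clamp 0 T t) (e / 2) (divr_gt0 e0 (ltr0Sn _ _)).
  have -> : zs t - zs (clamp 0 T t) = (zs t - z q t) - (zs (clamp 0 T t) - z q (clamp 0 T t)).
    by rewrite -zT; apply/rowP => i; rewrite !mxE; ring.
  by apply: (le_trans (ler_normB _ _)); rewrite add0r (splitr e) lerD// ltW.
have H p : exists q, (p <= q)%N /\ forall t, `|zs t - z q t| <= p.+1%:R^-1.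
  pose e : R := p.+1%:R^-1.
  have e0 : 0 < e by rewrite invr_gt0 ltr0n.
  (* The mesh T / N satisfies M T / N <= e / 3, one third of the error for each of the three terms
     below. *)
  pose N := (Num.truncn (3 * M * T / e)).+1.
  have N0 : 0 < N%:R :> R by rewrite ltr0n.
  have NM : 3 * M * T / e < N%:R by exact: truncnS_gt.
  have [q pq Hq] := clz p N.+1 (e / 3) (fun j : 'I_N.+1 => j%:R * T / N%:R) (divr_gt0 e0 (ltr0Sn _ _)).
  exists q; split => // t; rewrite zsT zT; have := clamp_bound t (ltW T0).
  move: (clamp 0 T t) => {}t /andP[t0 tT].
  have tN0 : 0 <= t * N%:R / T by rewrite divr_ge0 ?(ltW T0)// mulr_ge0// ltW.
  (* Index of the grid point just left of t; t = T gives index N, hence N + 1 grid points. *)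
  pose j0 := Num.truncn (t * N%:R / T).
  have hj0 : j0%:R <= t * N%:R / T by rewrite truncn_le.
  have hj1 : t * N%:R / T < j0.+1%:R by exact: truncnS_gt.
  have j0N : (j0 < N.+1)%N.
    rewrite ltnS -(ler_nat R) (le_trans hj0)//.
    by rewrite ler_pdivrMr// mulrC ler_pM2l.
  pose j := Ordinal j0N; pose s := j0%:R * T / N%:R.
  have st : `|s - t| <= T / N%:R.
    have h1 : s <= t by rewrite /s ler_pdivrMr// -ler_pdivlMr// truncn_le.
    have h2 : t <= s + T / N%:R.
      rewrite /s -mulrDl ler_pdivlMr// -{2}(mul1r T) -mulrDl -ler_pdivrMr//.
      by rewrite natr1 ltW// hj1.
    by rewrite distrC ger0_norm ?subr_ge0// lerBlDl.
  have Hs : `|zs s - z q s| < e / 3 := Hq j.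
  have Mst : M * `|s - t| <= e / 3.
    apply: (le_trans (ler_wpM2l M0 st)).
    rewrite mulrA ler_pdivrMr//; move: NM; rewrite ltr_pdivrMr//; lra.
  have -> : zs t - z q t = (zs s - z q s) + (z q s - z q t) - (zs s - zs t).
    by apply/rowP => i; rewrite !mxE; ring.
  apply: (le_trans (ler_normB _ _)); have := ler_normD (zs s - z q s) (z q s - z q t).
  have := zM q s t; have := zsM s t; rewrite -/e; lra.
have [sg Hsg] := choice H.
by exists zs, sg; split => // p; [have [] := Hsg p|have [_] := Hsg p].
Qed.

End equicontinuous_compactness.

(** * Integral of the exponential weight *)

Section exponential_integral.
Variable R : realType.

Lemma int_exp (a c : R) : 0 < a -> 0 <= c ->
  I[0, c] (fun s => a * expR (a * s)) = expR (a * c) - 1.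
Proof.
move=> a0; rewrite le_eqVlt => /predU1P[<-|c0].
  rewrite mulr0 expR0 subrr; apply/eqP; rewrite -normr_le0.
  have mf : Lmf (fun s => a * expR (a * s)).
    apply: LmfM; first exact: Lmf_cst.
    apply: Lmf_continuous => t; apply: (@continuous_comp _ _ _ (fun s => a * s) (@expR R)).
      by apply: cvgM; [exact: cvg_cst|exact: cvg_id].
    exact: continuous_expR.
  have := @int_le R a _ 0 0 (lexx 0) mf; rewrite subrr mulr0; apply => t.
  move=> /andP[t0 t1]; have -> : t = 0 by apply/eqP; rewrite eq_le t0 t1.
  by rewrite mulr0 expR0 mulr1 gtr0_norm.
have d (s : R) : is_derive s 1 (fun s : R => expR (a * s)) (a * expR (a * s)).
  have d1 : is_derive s 1 (fun s : R => a * s) a.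
    by apply: is_derive_eq; rewrite [_%:A]mulr1.
  by have d2 := @is_derive1_comp R expR (fun s : R => a * s) s _ _ (is_derive_expR _) d1;
    apply: (is_derive_eq d2); rewrite mulrC.
have ce : continuous (fun s : R => expR (a * s)).
  move=> s; have [ds _] := d s.
  by apply/differentiable_continuous/derivable1_diffP.
have cg : continuous (fun s : R => a * expR (a * s)).
  by move=> s; apply: cvgM; [exact: cvg_cst|exact: ce].
have cb : (@Leb R).-integrable (`[0, c]%classic : set (LT R)) (EFin \o (fun s : R => a * expR (a * s))).
  apply: (@bounded_itv_integrable _ (a * expR (a * c))); first exact: Lmf_continuous.
  move=> t /andP[t0 tc]; rewrite ger0_norm ?mulr_ge0 ?expR_ge0 ?(ltW a0)//.
  by rewrite ler_pM2l// ler_expR ler_pM2l.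
rewrite (Rintegral_Leb _ _ cb).2; last 2 first.
- exact: measurable_itv.
- exact: continuous_measurable_fun.
rewrite /Rintegral (@continuous_FTC2 _ _ (fun s : R => expR (a * s)))//.
- by rewrite /= mulr0 expR0.
- exact: continuous_subspaceT.
- split.
  + by move=> s _; have [] := d s.
  + by apply: cvg_at_right_filter; exact: ce.
  + by apply: cvg_at_left_filter; exact: ce.
- by move=> s _; rewrite derive1E; have [] := d s.
Qed.

End exponential_integral.

(** * The Volterra equation *)

Section volterra.
Variables (R : realType) (n m : nat) (tau T : R).
Hypothesis T0 : 0 < T.
Variable G : 'rV[R]_n -> 'rV[R]_n -> 'rV[R]_m -> 'rV[R]_n.
Variable U : set 'rV[R]_m.
Variable dl : (R -> 'rV[R]_n) -> R -> 'rV[R]_n.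
Variable phic : R -> 'rV[R]_n.
Variables K C0 : R.

(** Membership in [U] holds at every time, so that the bounds on [G] apply pointwise;
    [feasible_ctrl] provides such a representative. *)
Definition ctrl (u : R -> 'rV[R]_m) :=
  (forall i, Lmf (fun t => u t 0 i)) /\ forall t, U (u t).

Hypothesis K0 : 0 < K.
Hypothesis GK : forall x y v w a B, U a -> `|x - y| <= B -> `|v - w| <= B ->
  `|G x v a - G y w a| <= K * B.
Hypothesis GC : forall a, U a -> `|G 0 0 a| <= C0.
Hypothesis Gm : forall x v u i, cbd x -> cbd v -> ctrl u ->
  Lmf (fun s => G (x s) (v s) (u s) 0 i).
Hypothesis dl_lip : forall x y B t, cbd x -> cbd y ->
  (forall s, t - tau <= s <= t -> `|x s - y s| <= B) -> `|dl x t - dl y t| <= B.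
Hypothesis dl_cbd : forall x, cbd x -> cbd (dl x).
Hypothesis phic_cbd : cbd phic.

Definition rhs (u : R -> 'rV[R]_m) (x : R -> 'rV[R]_n) (s : R) := G (x s) (dl x s) (u s).

(* Integrating up to [clamp 0 T t] extends states to constants beyond T, so that they live on all of R. *)
Definition vol u x (t : R) : 'rV[R]_n :=
  phic t + \row_i I[0, clamp 0 T t] (fun s => rhs u x s 0 i).

Let clT t : 0 <= clamp 0 T t <= T.
Proof. exact: clamp_bound (ltW T0). Qed.

Let cst0 : cbd (fun=> 0 : 'rV[R]_n).
Proof. by split; [exact: cst_continuous|exists 0 => s; rewrite normr0]. Qed.

(** Comparison with the zero state gives an [M] that depends on [B] alone; this uniformity over
    controls makes the states equi-Lipschitz. *)
Lemma rhs_bound (B : R) : exists M, forall u x, ctrl u -> cbd x ->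
  (forall t, `|x t| <= B) -> forall t, `|rhs u x t| <= M.
Proof.
have [_ [D0 dl0]] := dl_cbd cst0.
exists (K * (B + D0) + C0) => u x [_ uU] cx xB t.
have -> : rhs u x t = (G (x t) (dl x t) (u t) - G 0 0 (u t)) + G 0 0 (u t) by rewrite subrK.
apply: (le_trans (ler_normD _ _)); apply: lerD; last exact: GC.
have B0 : 0 <= B := le_trans (normr_ge0 _) (xB 0).
have D00 : 0 <= D0 := le_trans (normr_ge0 _) (dl0 0).
apply: GK; rewrite ?subr0//; first by apply: (le_trans (xB t)); rewrite lerDl.
have -> : dl x t = (dl x t - dl (fun=> 0) t) + dl (fun=> 0) t by rewrite subrK.
apply: (le_trans (ler_normD _ _)); apply: lerD => //.
by apply: dl_lip => // s _; rewrite subr0.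
Qed.

Lemma rhs_bmf (M : R) u x i : ctrl u -> cbd x -> (forall t, `|rhs u x t| <= M) ->
  bmf M (fun s => rhs u x s 0 i).
Proof.
move=> cu cx H; split; first by apply: Gm => //; exact: dl_cbd.
by move=> t; exact: le_trans (mx_norm_ge _ _ _) (H t).
Qed.

(** [phic] is subtracted because the history is merely continuous; only the integral part is
    Lipschitz on the whole line. *)
Lemma vol_lipschitz (M : R) u x s t : ctrl u -> cbd x -> (forall t, `|rhs u x t| <= M) ->
  `|(vol u x s - phic s) - (vol u x t - phic t)| <= M * `|s - t|.
Proof.
move=> cu cx HM; have M0 : 0 <= M := le_trans (normr_ge0 _) (HM 0).
apply: mx_norm_le => [|i j]; first by rewrite mulr_ge0.
rewrite ord1 /vol ![phic _ + _]addrC !addrK !mxE.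
apply: (le_trans (primitive_lipschitz _ _ (@rhs_bmf M u x j cu cx HM))).
by rewrite ler_wpM2l// clamp_lipschitz.
Qed.

Lemma vol_clamp u x t : vol u x t - phic t = vol u x (clamp 0 T t) - phic (clamp 0 T t).
Proof.
rewrite /vol ![phic _ + _]addrC !addrK.
by apply/rowP => i; rewrite !mxE [clamp 0 T (clamp _ _ _)]clamp_id.
Qed.

Lemma vol_bound (M : R) u x t : ctrl u -> cbd x -> (forall t, `|rhs u x t| <= M) ->
  `|vol u x t - phic t| <= M * T.
Proof.
move=> cu cx HM; have M0 : 0 <= M := le_trans (normr_ge0 _) (HM 0).
apply: mx_norm_le => [|i j]; first by rewrite mulr_ge0// ltW.
rewrite ord1 /vol [phic _ + _]addrC addrK mxE.
have bj := @rhs_bmf M u x j cu cx HM.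
have /andP[c0 cT] := clT t.
apply: (le_trans (int_le c0 bj.1 (fun s _ => bj.2 s))).
by rewrite ler_wpM2l// subr0.
Qed.

Lemma lipschitz_cbd (x : R -> 'rV[R]_n) (M B : R) :
  (forall s t, `|(x s - phic s) - (x t - phic t)| <= M * `|s - t|) ->
  (forall t, `|x t - phic t| <= B) -> cbd x.
Proof.
move=> /lipschitz_continuous cx xB; split.
  have -> : x = (fun t => (x t - phic t) + phic t) by apply/funext => t; rewrite subrK.
  by move=> t; apply: cvgD; [exact: cx|exact: phic_cbd.1].
have [_ [D pD]] := phic_cbd.
exists (B + D) => t; rewrite -(subrK (phic t) (x t)).
by apply: (le_trans (ler_normD _ _)); exact: lerD.
Qed.

Lemma vol_cbd u x : ctrl u -> cbd x -> cbd (vol u x).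
Proof.
move=> cu cx; have [_ [B xB]] := cx; have [M HM] := rhs_bound B.
have HM' := HM u x cu cx xB.
apply: (@lipschitz_cbd _ M (M * T)) => [s t|t]; first exact: vol_lipschitz.
exact: vol_bound.
Qed.

(* The weight e^(2 K t) turns the Volterra operator into a contraction on the whole of [0, T]. *)
Let wt (t : R) := expR (2 * K * clamp 0 T t).

(** The delay sees only past times and the weight is nondecreasing, so at time s the right-hand
    sides differ by at most K D e^(2 K s). Its integral up to c is D / 2 (e^(2 K c) - 1): the 2 in
    the exponent is what makes the ratio 1/2. *)
Lemma vol_contraction (D : R) u x y : ctrl u -> cbd x -> cbd y ->
  (forall t, `|x t - y t| <= D * wt t) ->
  forall t, `|vol u x t - vol u y t| <= D / 2 * wt t.
Proof.
move=> cu cx cy xy t.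
have D0 : 0 <= D.
  by have := le_trans (normr_ge0 _) (xy 0); rewrite pmulr_lge0// expR_gt0.
have wle s r : s <= r -> wt s <= wt r.
  move=> sr; rewrite /wt ler_expR ler_pM2l ?mulr_gt0//.
  exact: clamp_homo.
have Hr s : `|rhs u x s - rhs u y s| <= K * (D * wt s).
  apply: GK; [exact: cu.2|exact: xy|].
  apply: dl_lip => // r /andP[_ rs]; apply: (le_trans (xy r)).
  by rewrite ler_wpM2l// wle.
have [_ [Bx xB]] := cx; have [Mx HMx] := rhs_bound Bx; have {HMx}HMx := HMx u x cu cx xB.
have [_ [By yB]] := cy; have [My HMy] := rhs_bound By; have {HMy}HMy := HMy u y cu cy yB.
apply: mx_norm_le => [|i j]; first by rewrite mulr_ge0 ?expR_ge0// divr_ge0.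
have bx := @rhs_bmf Mx u x j cu cx HMx.
have by_ := @rhs_bmf My u y j cu cy HMy.
rewrite ord1 /vol opprD addrACA subrr add0r !mxE /wt.
have /andP[c0 cT] := clT t; move: (clamp 0 T t) c0 cT => c c0 cT.
have -> : I[0, c] (fun s => rhs u x s 0 j) - I[0, c] (fun s => rhs u y s 0 j) =
    I[0, c] (fun s => rhs u x s 0 j - rhs u y s 0 j).
  by rewrite RintegralB//; [exact: measurable_itv_Leb|exact: bmf_integrable bx|exact: bmf_integrable by_].
have bD : bmf (Mx + My) (fun s => rhs u x s 0 j - rhs u y s 0 j).
  split; first by apply: LmfB; [exact: bx.1|exact: by_.1].
  by move=> s; apply: (le_trans (ler_normB _ _)); apply: lerD; [exact: bx.2|exact: by_.2].
pose e s := 2 * K * expR (2 * K * s).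
have K20 : 0 < 2 * K by rewrite mulr_gt0.
have be : (@Leb R).-integrable (`[0, c]%classic : set (LT R)) (EFin \o (fun s => D / 2 * e s)).
  apply: (@bounded_itv_integrable _ (D / 2 * e c)).
    apply: LmfM; first exact: Lmf_cst.
    apply: LmfM; first exact: Lmf_cst.
    apply: Lmf_continuous => s; apply: (@continuous_comp _ _ _ (fun s => 2 * K * s) (@expR R)).
      by apply: cvgM; [exact: cvg_cst|exact: cvg_id].
    exact: continuous_expR.
  move=> s /andP[s0 sc]; rewrite /e ger0_norm ?mulr_ge0 ?expR_ge0 ?invr_ge0 ?(ltW K0)//.
  by rewrite ler_wpM2l ?divr_ge0// ler_pM2l// ler_expR ler_pM2l.
have mi := @measurable_itv_Leb R `[0, c].
apply: (le_trans (le_normr_Rintegral mi (bmf_integrable 0 c bD))).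
apply: (@le_trans _ _ (I[0, c] (fun s => D / 2 * e s))).
  apply: le_Rintegral => //.
  - by apply: integrable_norm; exact: bmf_integrable bD.
  - move=> s; rewrite /= in_itv /= => /andP[s0 sc].
    apply: (@le_trans _ _ (K * (D * wt s))).
      apply: le_trans (Hr s).
      by have := mx_norm_ge (rhs u x s - rhs u y s) 0 j; rewrite !mxE.
    rewrite /e /wt clamp_id ?s0 ?(le_trans sc)// le_eqVlt; apply/orP; left; apply/eqP.
    by field.
have -> : I[0, c] (fun s => D / 2 * e s) = D / 2 * I[0, c] e.
  rewrite RintegralZl//; apply: (@bounded_itv_integrable _ (e c)).
    apply: LmfM; first exact: Lmf_cst.
    apply: Lmf_continuous => s; apply: (@continuous_comp _ _ _ (fun s => 2 * K * s) (@expR R)).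
      by apply: cvgM; [exact: cvg_cst|exact: cvg_id].
    exact: continuous_expR.
  move=> s /andP[s0 sc]; rewrite /e ger0_norm ?mulr_ge0 ?expR_ge0 ?(ltW K0)//.
  by rewrite ler_pM2l// ler_expR ler_pM2l.
by rewrite int_exp// ler_wpM2l ?divr_ge0// gerBl.
Qed.

Lemma wt_ge1 t : 1 <= wt t.
Proof.
rewrite -expR0 ler_expR mulr_ge0 ?mulr_ge0 ?(ltW K0)//.
by have /andP[] := clT t.
Qed.

Lemma wt_le t : wt t <= expR (2 * K * T).
Proof.
rewrite ler_expR ler_pM2l ?mulr_gt0//.
by have /andP[] := clT t.
Qed.

(** Let Y be the weighted sup norm of [x], finite because [x] is bounded. Comparing x = vol u x with
    the image of zero, bounded by B0 for every control, gives Y <= B0 + Y / 2, hence Y <= 2 B0. *)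
Lemma a_priori_bound : exists B, forall u x, ctrl u -> cbd x ->
  (forall t, x t = vol u x t) -> forall t, `|x t| <= B.
Proof.
have [M HM] := rhs_bound 0.
have [_ [D pD]] := phic_cbd.
pose B0 := M * T + D.
exists (2 * B0 * expR (2 * K * T)) => u x cu cx xE t.
have v0 s : `|vol u (fun=> 0) s| <= B0.
  rewrite -(subrK (phic s) (vol _ _ _)); apply: (le_trans (ler_normD _ _)); apply: lerD => //.
  by apply: vol_bound => //; apply: HM => // r; rewrite normr0.
have [_ [X xX]] := cx.
pose Y := sup (range (fun s => `|x s| / wt s)).
have hsup : has_sup (range (fun s => `|x s| / wt s)).
  split; first by exists (`|x 0| / wt 0); exists 0.
  exists X => _ [s _ <-]; apply: le_trans (xX s).
  by rewrite ler_pdivrMr ?expR_gt0// ler_peMr// wt_ge1.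
have xY s : `|x s - 0| <= Y * wt s.
  rewrite subr0 -ler_pdivrMr ?expR_gt0//.
  by apply: sup_ubound; [exact: hsup.2|exists s].
have Yle : Y <= B0 + Y / 2.
  apply: sup_le_ub; first exact: hsup.1.
  move=> _ [s _ <-]; rewrite ler_pdivrMr ?expR_gt0//.
  have -> : x s = (vol u x s - vol u (fun=> 0) s) + vol u (fun=> 0) s by rewrite subrK.
  apply: (le_trans (ler_normD _ _)); rewrite addrC mulrDl; apply: lerD.
    apply: (le_trans (v0 s)); rewrite ler_peMr ?wt_ge1//.
    exact: le_trans (normr_ge0 _) (v0 s).
  exact: (vol_contraction cu cx cst0 xY).
have Y0 : 0 <= Y.
  by have := le_trans (normr_ge0 _) (xY 0); rewrite pmulr_lge0// expR_gt0.
have := xY t; rewrite subr0 => /le_trans; apply.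
apply: ler_pM => //; [exact: expR_ge0|lra|exact: wt_le].
Qed.

Lemma picard u : ctrl u -> exists2 x, cbd x & forall t, x t = vol u x t.
Proof.
move=> cu; pose X p := iter p (vol u) phic.
have cX p : cbd (X p) by elim: p => [|p IH] /=; [exact: phic_cbd|exact: vol_cbd].
have [_ [X0 H0]] := cX 0%N; have [_ [X1 H1]] := cX 1%N.
pose A := X1 + X0.
have A0 : 0 <= A by rewrite addr_ge0// (le_trans (normr_ge0 _) (H1 0), le_trans (normr_ge0 _) (H0 0)).
have step p t : `|X p.+1 t - X p t| <= A * (2^-1) ^+ p * wt t.
  elim: p t => [|p IH] t.
    rewrite expr0 mulr1; apply: (@le_trans _ _ A); last by rewrite ler_peMr// wt_ge1.
    by apply: (le_trans (ler_normB _ _)); apply: lerD.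
  by have := vol_contraction cu (cX p.+1) (cX p) IH t; rewrite exprSr mulrA.
pose W := expR (2 * K * T).
have step2 p t : `|X p.+1 t - X p t| <= A * W * (2^-1) ^+ p.
  apply: (le_trans (step p t)); rewrite mulrAC ler_wpM2r ?exprn_ge0//.
  by rewrite ler_wpM2l// wt_le.
have lim_ex (ti : R * 'I_n) : exists l, forall p,
    `|X p ti.1 0 ti.2 - l| <= 2 * (A * W) * (2^-1) ^+ p.
  apply: geometric_cauchy => p; apply: le_trans (step2 p ti.1).
  by have := mx_norm_ge (X p.+1 ti.1 - X p ti.1) 0 ti.2; rewrite !mxE.
have [l Hl] := choice lim_ex.
pose x (t : R) : 'rV[R]_n := \row_i l (t, i).
pose ep p := 2 * (A * W) * (2^-1) ^+ p.
have W0 : 0 <= W := expR_ge0 _.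
have ep0 p : 0 <= ep p by rewrite !mulr_ge0 ?exprn_ge0.
have Xx p t : `|X p t - x t| <= ep p.
  by apply: mx_norm_le => // i j; rewrite ord1 !mxE; exact: Hl (t, j) p.
have cep : ep p @[p --> \oo] --> (0 : R).
  rewrite -(mulr0 (2 * (A * W))); apply: cvgM; first exact: cvg_cst.
  by apply: cvg_expr; rewrite ger0_norm ?invr_ge0// invf_lt1// ltr1n.
have small e : 0 < e -> exists p, ep p < e.
  move=> e0; have /cvgrPdist_lt/(_ _ e0)[N _ /(_ N (leqnn N))] := cep.
  by rewrite sub0r normrN ger0_norm//; exists N.
have xB t : `|x t| <= ep 0%N + X0.
  have -> : x t = X 0%N t - (X 0%N t - x t) by rewrite opprB addrC subrK.
  by apply: (le_trans (ler_normB _ _)); rewrite addrC lerD.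
have XB p t : `|X p t| <= ep 0%N + (ep 0%N + X0).
  have -> : X p t = (X p t - x t) + x t by rewrite subrK.
  apply: (le_trans (ler_normD _ _)); apply: lerD (xB t).
  apply: (le_trans (Xx p t)); rewrite ler_wpM2l ?mulr_ge0// exprn_ile1 ?invr_ge0//.
  by rewrite invf_le1// ler1n.
have [M HM] := rhs_bound (ep 0%N + (ep 0%N + X0)).
have HMp p := HM u (X p) cu (cX p) (XB p).
(* Continuity of the limit is obtained from this bound, which all iterates satisfy with the same
   [M]. *)
have xlip s t : `|(x s - phic s) - (x t - phic t)| <= M * `|s - t|.
  apply/ler_addgt0Pr => e e0; have [p Hp] := small (e / 2) (divr_gt0 e0 (ltr0Sn _ _)).
  have := vol_lipschitz s t cu (cX p) (HMp p).
  have h1 := Xx p.+1 s; have h2 := Xx p.+1 t.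
  have epS : ep p.+1 <= ep p.
    by rewrite /ep exprS ler_wpM2l ?mulr_ge0// ler_piMl ?exprn_ge0// invf_le1// ler1n.
  have -> : x s - phic s - (x t - phic t) = (vol u (X p) s - phic s - (vol u (X p) t - phic t))
     - (X p.+1 s - x s) + (X p.+1 t - x t).
    by apply/rowP => i; rewrite !mxE; ring.
  move=> h3; apply: (le_trans (ler_normD _ _)).
  have := ler_normB (vol u (X p) s - phic s - (vol u (X p) t - phic t)) (X p.+1 s - x s).
  lra.
have [_ [D pD]] := phic_cbd.
have cx : cbd x.
  apply: (lipschitz_cbd xlip (B := (ep 0%N + X0) + D)) => t.
  by apply: (le_trans (ler_normB _ _)); exact: lerD.
exists x => // t; apply/eqP; rewrite -subr_eq0 -normr_le0; apply/ler_addgt0Pr => e e0.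
rewrite add0r.
(* The defect of [x] is at most ep p / 2 * W from the contraction plus ep p.+1 from the next
   iterate, well below ep p * (2 + W). *)
have eW : 0 < e / (2 + W) by rewrite divr_gt0// ltr_wpDr.
have [p Hp] := small _ eW.
have Xw s : `|X p s - x s| <= ep p * wt s.
  by apply: (le_trans (Xx p s)); rewrite ler_peMr// wt_ge1.
have h1 := vol_contraction cu (cX p) cx Xw t.
have h2 := Xx p.+1 t.
have -> : x t - vol u x t = (vol u (X p) t - vol u x t) - (X p.+1 t - x t).
  by apply/rowP => i; rewrite !mxE; ring.
apply: (le_trans (ler_normB _ _)).
have epS : ep p.+1 <= ep p.
  by rewrite /ep exprS ler_wpM2l ?mulr_ge0// ler_piMl ?exprn_ge0// invf_le1// ler1n.
have h3 : ep p * wt t <= ep p * W by rewrite ler_wpM2l// wt_le.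
have h4 : ep p * (2 + W) < e by rewrite -ltr_pdivlMr// ltr_wpDr.
have h5 : 0 <= ep p * wt t by rewrite mulr_ge0// expR_ge0.
have h6 : ep p / 2 * wt t = (ep p * wt t) / 2 by rewrite mulrAC.
rewrite h6 in h1; move: (ep0 p) h1 h2 h3 h4 h5 epS.
rewrite mulrDr; lra.
Qed.

End volterra.

(** * Convex combinations of tails *)

Section convex_weights.
Variable R : realType.
Implicit Types (w a b : nat -> R).

(* w is a finitely supported convex weight on the indices k with n <= k < N. *)
Definition cvxw (n N : nat) w :=
  [/\ forall k, 0 <= w k, forall k, (k < n)%N -> w k = 0,
      forall k, (N <= k)%N -> w k = 0 & \sum_(0 <= k < N) w k = 1].

Lemma unit_cvxw n : cvxw n n.+1 (fun k => (k == n)%:R).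
Proof.
split => [k|k kn|k nk|]; first exact: ler0n.
- by rewrite ltn_eqF.
- by rewrite gtn_eqF.
- rewrite big_nat_recr//= eqxx [X in X + _]big_nat_cond [X in X + _]big1 ?add0r//.
  by move=> k /andP[/andP[_ kn] _]; rewrite ltn_eqF.
Qed.

Definition comb (N : nat) w a := \sum_(0 <= k < N) w k * a k.

Lemma sum_widen (N N' : nat) (F : nat -> R) : (N <= N')%N ->
  (forall k, (N <= k)%N -> F k = 0) -> \sum_(0 <= k < N') F k = \sum_(0 <= k < N) F k.
Proof.
move=> NN' F0; rewrite (big_cat_nat (n := N))//= [X in _ + X]big_nat_cond [X in _ + X]big1 ?addr0//.
by move=> k /andP[/andP[Nk _] _]; exact: F0.
Qed.

Lemma comb_widen n N N' w a : cvxw n N w -> (N <= N')%N -> comb N' w a = comb N w a.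
Proof. by move=> [_ _ w0 _] NN'; apply: sum_widen => // k /w0 ->; rewrite mul0r. Qed.

Lemma cvxw_avg n N w n' N' w' : cvxw n N w -> cvxw n' N' w' ->
  cvxw (minn n n') (maxn N N') (fun k => (w k + w' k) / 2).
Proof.
move=> W W'; have [w0 wn wN w1] := W; have [w0' wn' wN' w1'] := W'; split.
- by move=> k; rewrite divr_ge0// addr_ge0.
- by move=> k; rewrite leq_min => /andP[/wn -> /wn' ->]; rewrite addr0 mul0r.
- by move=> k; rewrite geq_max => /andP[/wN -> /wN' ->]; rewrite addr0 mul0r.
- rewrite -mulr_suml big_split /= (sum_widen (leq_maxl N N') wN).
  by rewrite (sum_widen (leq_maxr N N') wN') w1 w1'; lra.
Qed.

Lemma comb_avg n N w n' N' w' a : cvxw n N w -> cvxw n' N' w' ->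
  comb (maxn N N') (fun k => (w k + w' k) / 2) a = (comb N w a + comb N' w' a) / 2.
Proof.
move=> W W'; rewrite -(comb_widen a W (leq_maxl N N')) -(comb_widen a W' (leq_maxr N N')).
rewrite /comb -big_split /= mulr_suml; apply: eq_bigr => k _; ring.
Qed.

Lemma comb_cst n N w (c : R) : cvxw n N w -> comb N w (fun=> c) = c.
Proof. by move=> [_ _ _ w1]; rewrite /comb -mulr_suml w1 mul1r. Qed.

Lemma comb_le n N w a b : cvxw n N w -> (forall k, (n <= k)%N -> a k <= b k) ->
  comb N w a <= comb N w b.
Proof.
move=> [w0 wn _ _] ab; apply: ler_sum => k _.
by case: (ltnP k n) => [/wn ->|/ab]; [rewrite !mul0r|exact: ler_wpM2l].
Qed.

Lemma combB N w a b : comb N w (fun k => a k - b k) = comb N w a - comb N w b.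
Proof. by rewrite /comb -sumrB; apply: eq_bigr => k _; rewrite mulrBr. Qed.

Lemma combD N w a b : comb N w (fun k => a k + b k) = comb N w a + comb N w b.
Proof. by rewrite /comb -big_split; apply: eq_bigr => k _; rewrite mulrDr. Qed.

Lemma combZ N w (c : R) a : comb N w (fun k => c * a k) = c * comb N w a.
Proof. by rewrite /comb mulr_sumr; apply: eq_bigr => k _; rewrite mulrCA. Qed.

Lemma comb_norm n N w a : cvxw n N w -> `|comb N w a| <= comb N w (fun k => `|a k|).
Proof.
move=> [w0 _ _ _]; apply: (le_trans (ler_norm_sum _ _ _)).
by apply: ler_sum => k _; rewrite normrM ger0_norm.
Qed.

Lemma comb_norm_le n N w a (M : R) : cvxw n N w -> (forall k, (n <= k)%N -> `|a k| <= M) ->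
  `|comb N w a| <= M.
Proof.
move=> W aM; apply: (le_trans (comb_norm _ W)).
by rewrite -[leRHS](comb_cst M W); exact: comb_le W aM.
Qed.

Variables (ns Ns : nat -> nat) (ws : nat -> nat -> R).
Hypothesis W : forall p, (p <= ns p)%N /\ cvxw (ns p) (Ns p) (ws p).

(** The counterpart of strong times weak convergence: [a] converges, [b] is bounded and converges
    only after averaging. On the tail carrying the weights (a k - al) * b k is uniformly small, so
    [a] may be replaced by its limit. *)
Lemma comb_cvg_mul a b (al be C : R) : a k @[k --> \oo] --> al ->
  (forall k, `|b k| <= C) -> comb (Ns p) (ws p) b @[p --> \oo] --> be ->
  comb (Ns p) (ws p) (fun k => a k * b k) @[p --> \oo] --> al * be.
Proof.
move=> aa bC bb.
have C0 : 0 <= C := le_trans (normr_ge0 _) (bC 0%N).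
have -> : (fun p => comb (Ns p) (ws p) (fun k => a k * b k)) =
    (fun p => comb (Ns p) (ws p) (fun k => (a k - al) * b k) + al * comb (Ns p) (ws p) b).
  apply/funext => p; rewrite -combZ -combD; congr comb; apply/funext => k; ring.
rewrite -[X in _ --> X]add0r; apply: cvgD; last by apply: cvgM => //; exact: cvg_cst.
apply/cvgrPdist_le => e e0.
have eC : 0 < e / (C + 1) by rewrite divr_gt0// ltr_wpDl.
have /cvgrPdist_le/(_ _ eC)[N _ HN] := aa.
exists N => // p /= Np; rewrite sub0r normrN; have [pn Wp] := W p.
apply: comb_norm_le Wp _ => k nk; rewrite normrM.
have Nk : (N <= k)%N by exact: leq_trans Np (leq_trans pn nk).
have := HN k Nk; rewrite distrC => h.
apply: (@le_trans _ _ (e / (C + 1) * (C + 1))); last by rewrite divfK// gt_eqF// ltr_wpDl.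
by apply: ler_pM => //; apply: (le_trans (bC k)); rewrite lerDl.
Qed.

Lemma comb_cvg a (al : R) : a k @[k --> \oo] --> al ->
  comb (Ns p) (ws p) a @[p --> \oo] --> al.
Proof.
move=> aa; have := @comb_cvg_mul a (fun=> 1) al 1 1 aa.
have -> : (fun k => a k * 1) = a by apply/funext => k; rewrite mulr1.
rewrite mulr1; apply => //; first by move=> _; rewrite normr1.
under eq_fun => p do rewrite (comb_cst _ (W p).2).
exact: cvg_cst.
Qed.

End convex_weights.

(** * Almost everywhere convergence from summable L^1 increments *)

Section ae_convergence.
Variables (R : realType) (T : R).
Hypothesis T0 : 0 < T.

Lemma int_EFin M (f : R -> R) : bmf M f ->
  (\int[@Leb R]_(t in `[0%R, T]%classic) (f t)%:E)%E = (I[0, T] f)%:E.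
Proof.
move=> bf; rewrite /Rintegral fineK//; apply: integrable_fin_num => //.
- exact: measurable_itv_Leb.
- exact: bmf_integrable bf.
Qed.

(** The sum F of the absolute increments has integral at most 2 C, hence is finite almost
    everywhere; there the telescoping series converges absolutely. *)
Lemma ae_cvg_summable (v : nat -> R -> R) (M C : R) : (forall p, bmf M (v p)) ->
  (forall p, I[0, T] (fun t => `|v p.+1 t - v p t|) <= C * 2^-1 ^+ p) ->
  aeL t, 0 <= t <= T -> cvgn (fun p => v p t).
Proof.
move=> bv vC.
pose f p t := `|v p.+1 t - v p t|.
have bf p : bmf (M + M) (f p).
  split; last first.
    move=> t; rewrite normr_id; apply: (le_trans (ler_normB _ _)).
    by apply: lerD; [exact: (bv p.+1).2|exact: (bv p).2].
  apply: (measurableT_comp (continuous_measurable_fun (@norm_continuous R R))).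
  by apply: LmfB; [exact: (bv p.+1).1|exact: (bv p).1].
have mi := @measurable_itv_Leb R `[0, T].
have mf p : measurable_fun (`[0, T]%classic : set (LT R)) (fun t => (f p t)%:E).
  by apply/measurable_EFinP; apply: measurable_funTS; exact: (bf p).1.
pose F t := (\sum_(0 <= p <oo) (f p t)%:E)%E.
have C0 : 0 <= C.
  have := vC 0%N; rewrite expr0 mulr1; apply: le_trans.
  by apply: Rintegral_ge0 => t _; exact: normr_ge0.
have intF : (\int[@Leb R]_(t in `[0%R, T]%classic) F t <= (2 * C)%:E)%E.
  rewrite integral_nneseries//; last by move=> p t _; rewrite lee_fin normr_ge0.
  apply: lime_le; first by apply: is_cvg_nneseries => p _ _; apply: integral_ge0 => t _; rewrite lee_fin normr_ge0.
  apply: nearW => N.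
  under eq_bigr => p _ do rewrite (int_EFin (bf p)).
  rewrite sumEFin lee_fin.
  suff : \sum_(0 <= p < N) I[0, T] (f p) <= 2 * C - 2 * C * 2^-1 ^+ N.
    by move=> /le_trans; apply; rewrite gerBl !mulr_ge0// exprn_ge0.
  elim: N => [|N IH]; first by rewrite big_geq// expr0 mulr1 subrr.
  rewrite big_nat_recr//=; have := vC N; rewrite exprS -/(f N); move: IH.
  by move: (\sum_(0 <= _ < N) _) (Rintegral _ _ _) => x y; lra.
have mF : measurable_fun (`[0, T]%classic : set (LT R)) F.
  by apply: ge0_emeasurable_sum => // p t _ _; rewrite lee_fin normr_ge0.
have F0 t : (0 <= F t)%E by apply: nneseries_ge0 => p _ _; rewrite lee_fin normr_ge0.
have iF : (@Leb R).-integrable (`[0, T]%classic : set (LT R)) F.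
  apply/integrableP; split => //.
  under eq_integral do rewrite gee0_abs//.
  by apply: le_lt_trans intF _; rewrite ltry.
have := integrable_ae mi iF; apply: aeLS => t + tT.
rewrite /= in_itv /= => /(_ tT); rewrite ge0_fin_numE// => Foo.
have cf : cvgn (series (f ^~ t)).
  apply: nondecreasing_is_cvgn.
    by apply/nondecreasing_seqP => N; rewrite /series /= big_nat_recr//= lerDl; exact: normr_ge0.
  exists (fine (F t)) => _ [N _ <-].
  have fF : F t \is a fin_num by rewrite ge0_fin_numE.
  rewrite -lee_fin fineK// /series /= -sumEFin.
  by apply: nneseries_lim_ge => p _ _; rewrite lee_fin; exact: normr_ge0.
have cs : cvgn (series (telescope (v ^~ t))) by exact: normed_cvg.
have -> : (fun p => v p t) = (fun p => v 0%N t + series (telescope (v ^~ t)) p).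
  by apply/funext => p; rewrite [LHS](eq_sum_telescope (v ^~ t)).
by apply: is_cvgD => //; exact: is_cvg_cst.
Qed.

End ae_convergence.

(** * Convex combinations of minimal norm *)

Section convex_compactness.
Variables (R : realType) (T : R) (m : nat) (u : nat -> R -> 'rV[R]_m) (M : R).
Hypothesis T0 : 0 < T.
Hypothesis mu : forall k i, Lmf (fun t => u k t 0 i).
Hypothesis uM : forall k t, `|u k t| <= M.

Let v N w i t := comb N w (fun k => u k t 0 i).
Let Q N w := I[0, T] (fun t => \sum_(i < m) (v N w i t) ^+ 2).

Let M0 : 0 <= M. Proof. exact: le_trans (normr_ge0 _) (uM 0%N 0). Qed.

Let vM n N w i t : cvxw n N w -> `|v N w i t| <= M.
Proof.
by move=> W; apply: comb_norm_le W _ => k _; exact: le_trans (mx_norm_ge _ _ _) (uM k t).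
Qed.

Let mv N w i : Lmf (v N w i).
Proof. by apply: Lmf_sum => k; apply: LmfM; [exact: Lmf_cst|exact: mu]. Qed.

Let bv n N w i : cvxw n N w -> bmf M (v N w i).
Proof. by move=> W; split => // t; exact: vM W. Qed.

Let bsum (f : 'I_m -> R -> R) (C : R) : (forall i, bmf C (f i)) ->
  bmf (\sum_(i < m) C) (fun t => \sum_(i < m) f i t).
Proof.
move=> bf; split; first by apply: Lmf_sum => i; exact: (bf i).1.
by move=> t; apply: (le_trans (ler_norm_sum _ _ _)); apply: ler_sum => i _; exact: (bf i).2.
Qed.

Let bsq (f : R -> R) (C : R) : bmf C f -> bmf (C ^+ 2) (fun t => f t ^+ 2).
Proof.
move=> bf; split; first by apply: LmfM; exact: bf.1.
by move=> t; rewrite normrX lerXn2r ?nnegrE// ?(le_trans (normr_ge0 _) (bf.2 t)) ?bf.2.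
Qed.

Let bQ n N w : cvxw n N w -> bmf (\sum_(i < m) M ^+ 2) (fun t => \sum_(i < m) (v N w i t) ^+ 2).
Proof. by move=> W; apply: bsum => i; apply: bsq; exact: bv W. Qed.

Let Q0 N w : 0 <= Q N w.
Proof. by apply: Rintegral_ge0 => t _; apply: sumr_ge0 => i _; exact: sqr_ge0. Qed.

Let QM n N w : cvxw n N w -> Q N w <= (\sum_(i < m) M ^+ 2) * T.
Proof.
move=> W; apply: (le_trans (ler_norm _)); rewrite -[X in _ * X]subr0.
by apply: int_le; [exact: ltW|exact: (bQ W).1|move=> t _; exact: (bQ W).2].
Qed.

Let parallelogram n N w n' N' w' : cvxw n N w -> cvxw n' N' w' ->
  I[0, T] (fun t => \sum_(i < m) (v N w i t - v N' w' i t) ^+ 2) =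
  2 * Q N w + 2 * Q N' w' - 4 * Q (maxn N N') (fun k => (w k + w' k) / 2).
Proof.
move=> W W'.
have b1 := bQ W; have b2 := bQ W'; have b3 := bQ (cvxw_avg W W').
pose S := \sum_(i < m) M ^+ 2.
pose g t := (2 * \sum_(i < m) (v N w i t) ^+ 2) + (2 * (\sum_(i < m) (v N' w' i t) ^+ 2) +
   ((- 4) * (\sum_(i < m) (v (maxn N N') (fun k => (w k + w' k) / 2) i t) ^+ 2))).
transitivity (I[0, T] g).
  apply: eq_Rintegral => t _; rewrite /g !mulr_sumr -!big_split /=; apply: eq_bigr => i _.
  by rewrite /v (comb_avg _ W W'); field.
rewrite {}/g.
have bZ (c C : R) f : bmf C f -> bmf (`|c| * C) (fun t => c * f t).
  move=> bf; split; first by apply: LmfM; [exact: Lmf_cst|exact: bf.1].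
  by move=> t; rewrite normrM ler_wpM2l// bf.2.
have b23 : bmf (`|2| * S + `|- 4| * S) (fun t => 2 * (\sum_(i < m) (v N' w' i t) ^+ 2) +
   ((- 4) * (\sum_(i < m) (v (maxn N N') (fun k => (w k + w' k) / 2) i t) ^+ 2))).
  split; first by apply: LmfD; [exact: (bZ _ _ _ b2).1|exact: (bZ _ _ _ b3).1].
  by move=> t; apply: (le_trans (ler_normD _ _)); apply: lerD; [exact: (bZ _ _ _ b2).2|exact: (bZ _ _ _ b3).2].
rewrite (int_lin 2 0 T b1 b23) (int_lin 2 0 T b2 (bZ _ _ _ b3)).
rewrite RintegralZl; [|exact: measurable_itv_Leb|exact: bmf_integrable b3].
by rewrite /Q mulNr addrA.
Qed.

(* Minimal-norm convex combinations of the tails of a bounded sequence are Cauchy in L^2,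
   by the parallelogram law; this replaces weak compactness and Mazur's lemma. *)
Lemma convex_ae_cvg : exists (ns Ns : nat -> nat) (ws : nat -> nat -> R),
  (forall p, (p <= ns p)%N /\ cvxw (ns p) (Ns p) (ws p)) /\
  aeL t, 0 <= t <= T -> forall i, cvgn (fun p => comb (Ns p) (ws p) (fun k => u k t 0 i)).
Proof.
pose S n := [set q | exists N w, cvxw n N w /\ q = Q N w].
have S1 n : S n !=set0 by exists (Q n.+1 (fun k => (k == n)%:R)), n.+1, (fun k => (k == n)%:R); split => //; exact: unit_cvxw.
have hS n : has_inf (S n).
  by split => //; exists 0 => _ [N [w [_ ->]]].
(* Tails shrink with n, so [d] is nondecreasing, and it is bounded; its supremum D is also its
   limit. *)
pose d n := inf (S n).
have dle n N w : cvxw n N w -> d n <= Q N w.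
  by move=> W; apply: ge_inf; [exact: (hS n).2|exists N, w].
have dmono n n' : (n <= n')%N -> d n <= d n'.
  move=> nn'; apply: lb_le_inf => // _ [N [w [[w0 wn wN w1] ->]]].
  by apply: dle; split => // k kn; apply: wn; exact: leq_trans kn nn'.
pose D := sup (range d).
have hD : has_sup (range d).
  split; first by exists (d 0%N), 0%N.
  exists ((\sum_(i < m) M ^+ 2) * T) => _ [n _ <-].
  by apply: le_trans (dle _ _ _ (unit_cvxw R n)) (QM (unit_cvxw R n)).
have dD n : d n <= D by apply: sup_ubound; [exact: hD.2|exists n].
(* Near-minimality up to 4^-p in squared norm gives increments of order 2^-p in norm, which are
   summable. *)
pose ep p : R := (4^-1) ^+ p.
have ep0 p : 0 < ep p by rewrite exprn_gt0// invr_gt0.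
have H p : exists x : nat * nat * (nat -> R), [/\ (p <= x.1.1)%N, cvxw x.1.1 x.1.2 x.2,
    D - ep p <= d x.1.1 & Q x.1.2 x.2 <= D + ep p].
  have [_ [n0 _ <-] Dn0] := sup_adherent (ep0 p) hD.
  pose n := maxn p n0.
  have [_ [N [w [W ->]]] Hw] := inf_adherent (ep0 p) (hS n).
  exists (n, N, w); split => //=; first exact: leq_maxl.
    by apply: ltW; apply: (lt_le_trans Dn0); apply: dmono; exact: leq_maxr.
  by apply: ltW; apply: (lt_le_trans Hw); rewrite lerD2r dD.
have [x Hx] := choice H.
pose ns p := (x p).1.1; pose Ns p := (x p).1.2; pose ws p := (x p).2.
exists ns, Ns, ws.
have W p : cvxw (ns p) (Ns p) (ws p) by have [] := Hx p.
split; first by move=> p; have [] := Hx p.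
have epS p : ep p.+1 <= ep p.
  by rewrite /ep exprS ler_piMl ?exprn_ge0 ?invr_ge0// invf_le1// ler1n.
(* The midpoint weight lives on the longer of the two tails, where Q is at least D - ep p; the
   parallelogram law then gives 2 (D + ep p) + 2 (D + ep p) - 4 (D - ep p) = 8 ep p. *)
have step p : I[0, T] (fun t => \sum_(i < m) (v (Ns p.+1) (ws p.+1) i t - v (Ns p) (ws p) i t) ^+ 2)
    <= 8 * ep p.
  rewrite (parallelogram (W p.+1) (W p)).
  have h1 := dle _ _ _ (cvxw_avg (W p.+1) (W p)).
  have h2 : D - ep p <= d (minn (ns p.+1) (ns p)).
    have [_ _ a1 _] := Hx p.+1; have [_ _ a2 _] := Hx p.
    rewrite /minn; case: ifP => _ //; apply: le_trans a1.
    by rewrite lerD2l lerN2.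
  have [_ _ _ h3] := Hx p.+1; have [_ _ _ h4] := Hx p.
  have := epS p; rewrite -/(Ns p) -/(ws p) -/(Ns p.+1) -/(ws p.+1) in h3 h4 *; lra.
(* From L^2 to L^1: the 4 is 2^p / 2 * 8 * 4^-p divided by 2^-p, and T / 2 comes from integrating
   the constant 2^-p / 2. *)
have stepi p i : I[0, T] (fun t => `|v (Ns p.+1) (ws p.+1) i t - v (Ns p) (ws p) i t|)
    <= (4 + T / 2) * 2^-1 ^+ p.
  pose f t := v (Ns p.+1) (ws p.+1) i t - v (Ns p) (ws p) i t.
  have bf j : bmf (M + M) (fun t => v (Ns p.+1) (ws p.+1) j t - v (Ns p) (ws p) j t).
    split; first by apply: LmfB.
    by move=> t; apply: (le_trans (ler_normB _ _)); apply: lerD; [exact: vM (W p.+1)|exact: vM (W p)].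
  have bs := bsum (fun j => bsq (bf j)).
  pose g t := 2 ^+ p / 2 * (\sum_(i < m) (v (Ns p.+1) (ws p.+1) i t - v (Ns p) (ws p) i t) ^+ 2)
    + 2^-1 ^+ p / 2.
  have b1 : bmf (`|2^-1 ^+ p / 2|) (fun _ : R => 2^-1 ^+ p / 2 : R).
    by split => //; exact: Lmf_cst.
  have p0 : 0 < (2 : R) ^+ p by rewrite exprn_gt0.
  apply: (@le_trans _ _ (I[0, T] g)).
    apply: le_Rintegral.
    - exact: measurable_itv_Leb.
    - by apply: integrable_norm; exact: bmf_integrable (bf i).
    - apply: (@bmf_integrable _ (`|2 ^+ p / 2| * (\sum_(i < m) (M + M) ^+ 2) + `|2^-1 ^+ p / 2|)).
      split; first by apply: LmfD => //; [apply: LmfM; [exact: Lmf_cst|exact: bs.1]|exact: b1.1].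
      move=> t; apply: (le_trans (ler_normD _ _)); apply: lerD => //.
      by rewrite normrM ler_wpM2l// bs.2.
    move=> t _; rewrite /g.
    apply: (@le_trans _ _ (2 ^+ p / 2 * (f t) ^+ 2 + 2^-1 ^+ p / 2)); last first.
      apply: lerD => //; apply: ler_wpM2l; first by rewrite divr_ge0// ltW.
      rewrite (bigD1 i)//= -[leLHS]addr0; apply: lerD; first exact: lexx.
      by apply: sumr_ge0 => j _; exact: sqr_ge0.
    (* AM-GM: 2 |f| <= 2^p f^2 + 2^-p *)
    rewrite -/(f t) -(real_normK (num_real (f t))) exprVn; move: `|f t| => z.
    have : 0 <= (2 ^+ p * z - 1) ^+ 2 / 2 ^+ p / 2 by rewrite !divr_ge0 ?sqr_ge0// ltW.
    have -> : (2 ^+ p * z - 1) ^+ 2 / 2 ^+ p / 2 = 2 ^+ p / 2 * z ^+ 2 + (2 ^+ p)^-1 / 2 - z.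
      by field; rewrite gt_eqF.
    by rewrite subr_ge0.
  rewrite /g (int_lin _ 0 T bs b1).
  have -> : I[0, T] (fun=> 2^-1 ^+ p / 2) = 2^-1 ^+ p / 2 * T.
    rewrite Rintegral_cst; last exact: measurable_itv_Leb.
    by rewrite [X in fine X](Leb_itv (ltW T0)) subr0.
  have e4 : ep p = 2^-1 ^+ p * 2^-1 ^+ p by rewrite /ep -exprMn; congr (_ ^+ _); field.
  have e2 : (2 : R) ^+ p * 2^-1 ^+ p = 1 by rewrite -exprMn mulfV ?expr1n.
  have := ler_wpM2l (divr_ge0 (ltW p0) (ler0n R 2)) (step p).
  have -> : 2 ^+ p / 2 * (8 * ep p) = 4 * 2^-1 ^+ p.
    rewrite e4; move: (2 ^+ p) (2^-1 ^+ p) e2 => a b ab.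
    have -> : a / 2 * (8 * (b * b)) = 4 * (a * b) * b by field.
    by rewrite ab mulr1.
  lra.
have ae i : aeL t, 0 <= t <= T -> cvgn (fun p => v (Ns p) (ws p) i t).
  exact: (ae_cvg_summable (fun p => bv i (W p)) (stepi ^~ i)).
(* The finitely many coordinates are indexed by naturals, so that a countable intersection of conull
   sets applies. *)
have aeN : aeL t, forall j : nat, forall i : 'I_m, nat_of_ord i = j -> 0 <= t <= T -> cvgn (fun p => v (Ns p) (ws p) i t).
  apply: aeL_forall => j; case: (ltnP j m) => jm; last first.
    by apply: aeW => t i ij; move: jm; rewrite -ij leqNgt ltn_ord.
  apply: aeLS (ae (Ordinal jm)) => t cvt i ij.
  by have -> : i = Ordinal jm by exact: val_inj.
by apply: aeLS aeN => t cvt tT i; exact: cvt.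
Qed.

End convex_compactness.

(** * Normal integrands *)

Section lower_semicontinuity.
Variable R : realType.

Lemma limn_einf_ge (a : nat -> \bar R) (l : R) :
  (forall e, 0 < e -> \forall p \near \oo, ((l - e)%:E <= a p)%E) ->
  (l%:E <= limn_einf a)%E.
Proof.
move=> H; apply/lee_addgt0Pr => e e0; rewrite -leeBlDr// -EFinB limn_einf_lim.
apply: lime_ge; first exact: is_cvg_einfs.
have [N _ HN] := H e e0.
exists N => // n /= Nn; apply: le_ereal_inf_tmp => _ [p /= np <-].
by apply: HN => /=; exact: leq_trans Nn np.
Qed.

Lemma limn_einf_le (a : nat -> \bar R) (c : R) :
  (forall p, (a p <= (c + p.+1%:R^-1)%:E)%E) -> (limn_einf a <= c%:E)%E.
Proof.
move=> H; rewrite limn_einf_lim; apply: lime_le; first exact: is_cvg_einfs.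
apply: nearW => n; apply/lee_addgt0Pr => e e0.
have [N _ HN] := near_infty_natSinv_lt (PosNum e0).
apply: (@le_trans _ _ (a (maxn n N))).
  by apply: ereal_inf_lbound; exists (maxn n N) => //=; exact: leq_maxl.
apply: (le_trans (H _)); rewrite lee_fin lerD2l ltW//.
exact: HN (leq_maxr _ _).
Qed.

Context d (S : measurableType d) (mu : {measure set S -> \bar R}) (D : set S).
Hypothesis mD : measurable D.
Variables (ns Ns : nat -> nat) (ws : nat -> nat -> R).
Hypothesis W : forall p, (p <= ns p)%N /\ cvxw (ns p) (Ns p) (ws p).

(** Combinations of the integrals stay below c + 1/(p + 1), because the weights of index p act on k
    >= p. Only an eventual lower bound on the combined integrands is asked for, which is what
    convexity delivers; both the cost and the L^2 ball use this form. *)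
Lemma fatou_comb (f : nat -> S -> R) (h : S -> R) (c : R) :
  (forall k t, 0 <= f k t) -> (forall t, 0 <= h t) ->
  (forall k, measurable_fun D (f k)) -> measurable_fun D h ->
  (forall k, (\int[mu]_(t in D) (f k t)%:E <= (c + k.+1%:R^-1)%:E)%E) ->
  {ae mu, forall t, D t -> forall e, 0 < e ->
     \forall p \near \oo, h t - e <= comb (Ns p) (ws p) (fun k => f k t)} ->
  (\int[mu]_(t in D) (h t)%:E <= c%:E)%E.
Proof.
move=> f0 h0 mf mh fc hf.
pose F p t := (comb (Ns p) (ws p) (fun k => f k t))%:E.
have F0 p t : (0 <= F p t)%E.
  by rewrite lee_fin; apply: sumr_ge0 => k _; apply: mulr_ge0 => //; have [_ []] := W p.
have mF p : measurable_fun D (F p).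
  apply/measurable_EFinP; apply: measurable_sum => k.
  by apply: measurable_funM => //; exact: measurable_cst.
have intF p : (\int[mu]_(t in D) F p t <= (c + p.+1%:R^-1)%:E)%E.
  have [pn Wp] := W p; have [w0 wn _ w1] := Wp.
  have -> : (\int[mu]_(t in D) F p t =
      \sum_(0 <= k < Ns p) (ws p k)%:E * \int[mu]_(t in D) (f k t)%:E)%E.
    rewrite /F /comb; under eq_integral do rewrite -sumEFin.
    rewrite ge0_integral_sum//.
    - apply: eq_bigr => k _; rewrite -ge0_integralZl_EFin//.
      + by move=> t _; rewrite lee_fin.
      + exact/measurable_EFinP.
    - by move=> k; apply/measurable_EFinP; apply: measurable_funM => //; exact: measurable_cst.
    - by move=> k t _; rewrite lee_fin mulr_ge0.
  apply: (@le_trans _ _ (\sum_(0 <= k < Ns p) (ws p k * (c + p.+1%:R^-1))%:E)%E).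
    apply: lee_sum => k _; case: (ltnP k (ns p)) => kn.
      by rewrite wn// mul0r mul0e.
    rewrite EFinM; apply: lee_wpmul2l; first by rewrite lee_fin.
    apply: (le_trans (fc k)); rewrite lee_fin lerD2l lef_pV2 ?posrE ?ltr0n//.
    by rewrite ler_nat ltnS (leq_trans pn).
  by rewrite sumEFin -mulr_suml w1 mul1r.
apply: (@le_trans _ _ (\int[mu]_(t in D) (limn_einf (F ^~ t)))%E).
  apply: ae_ge0_le_integral => //.
  - by move=> t _; rewrite lee_fin.
  - exact/measurable_EFinP.
  - move=> t _; rewrite limn_einf_lim; apply: lime_ge; first exact: is_cvg_einfs.
    by apply: nearW => n; apply: le_ereal_inf_tmp => _ [p _ <-]; exact: F0.
  - apply: (emeasurable_fun_cvg (fun n t => einfs (F ^~ t) n)).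
      exact: measurable_fun_einfs.
    by move=> t _; rewrite limn_einf_lim; exact: is_cvg_einfs.
  - apply: filterS hf => t /= H Dt; apply: limn_einf_ge => e /(H Dt); apply: filterS => p.
    by rewrite lee_fin.
apply: (le_trans (fatou _ mD mF (fun p t _ => F0 p t))).
exact: limn_einf_le.
Qed.

End lower_semicontinuity.

Section normal_integrand.
Variables (R : realType) (n m : nat) (T : R).
Variable j : R -> 'rV[R]_n -> 'rV[R]_m -> R.
Hypothesis nj : normal_integrand T j.

(** The point lying e below the graph is outside the closed epigraph, together with a ball around
    it. *)
Lemma normal_lsc t x u e : `[0, T]%classic t -> 0 < e ->
  exists2 d, 0 < d & forall y v, `|x - y| < d -> `|u - v| < d -> j t x u - e < j t y v.
Proof.
move=> tT e0.
have [clj _] := nj.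
have oj : open (~` epi j t) by apply: closed_openC; exact: clj.
have p0 : (~` epi j t) ((x, u), j t x u - e).
  by rewrite /epi /=; apply/negP; rewrite -ltNge ltrBlDr ltrDl.
have /nbhs_ballP[d d0 Hd] : nbhs ((x, u), j t x u - e) (~` epi j t) by exact: open_nbhs_nbhs.
exists d => // y v xy uv; rewrite ltNge; apply/negP => H.
have : (~` epi j t) ((y, v), j t x u - e).
  apply: Hd; split; last exact: ballxx.
  by split; rewrite /= -ball_normE.
by apply.
Qed.

Lemma rat_row_approx p (v : 'rV[R]_p) (r : R) : 0 < r ->
  exists q : 'rV[rat]_p, forall i, `|v 0 i - ratr (q 0 i)| <= r.
Proof.
move=> r0; have H i : exists q : rat, `|v 0 i - ratr q| <= r.
  have vr : v 0 i < v 0 i + r by rewrite ltrDl.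
  have [q] := rat_in_itvoo vr; rewrite in_itv /= => /andP[vq qv].
  by exists q; rewrite distrC ger0_norm ?subr_ge0 ?(ltW vq)// lerBlDl ltW.
have [q Hq] := choice H; exists (\row_i q i) => i; rewrite mxE; exact: Hq.
Qed.

(** j(t, x(t), u(t)) <= a holds iff for every N some rational point q within [r N] of (x(t), u(t))
    has an epigraph point within 2 [r N] of (q, a); the converse uses lower semicontinuity. The
    right side is built countably from measurable sets, the hits of the epigraph with open balls
    being measurable by normality. *)
Lemma measurable_normal_comp (x : R -> 'rV[R]_n) (u : R -> 'rV[R]_m) :
  (forall i, Lmf (fun t => x t 0 i)) -> (forall i, Lmf (fun t => u t 0 i)) ->
  measurable_fun (`[0, T]%classic : set (LT R)) (fun t => j t (x t) (u t)).
Proof.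
move=> mx mu.
have mD : measurable (`[0, T]%classic : set (LT R)) := @measurable_itv_Leb R `[0, T].
pose r (N : nat) : R := N.+1%:R^-1.
have r0 N : 0 < r N by rewrite invr_gt0 ltr0n.
(* The radius is doubled so that any point within [r N] of the centre lies in the open ball. *)
pose O (a : R) (q : 'rV[rat]_n * 'rV[rat]_m) N : set (('rV[R]_n * 'rV[R]_m) * R) :=
  [set p | ball ((map_mx ratr q.1 : 'rV[R]_n, map_mx ratr q.2 : 'rV[R]_m), a) (r N + r N) p ].
pose hit a q N : set R := [set t | `[0, T]%classic t /\ exists p, O a q N p /\ epi j t p].
have mhit a q N : measurable (hit a q N : set (LT R)).
  by apply/LmeasurableP; apply: nj.2; exact: ball_open.
pose nr (q : 'rV[rat]_n * 'rV[rat]_m) N : set R :=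
  [set t | (forall i, `|x t 0 i - ratr (q.1 0 i)| <= r N) /\
           (forall i, `|u t 0 i - ratr (q.2 0 i)| <= r N)].
have mnr1 p (y : R -> 'rV[R]_p) (q : 'rV[rat]_p) N : (forall i, Lmf (fun t => y t 0 i)) ->
    measurable ([set t | forall i, `|y t 0 i - ratr (q 0 i)| <= r N] : set (LT R)).
  move=> my.
  have -> : [set t | forall i, `|y t 0 i - ratr (q 0 i)| <= r N] =
     \bigcap_(i in [set: 'I_p]) [set t | `|y t 0 i - ratr (q 0 i)| <= r N].
    by apply/seteqP; split => t H; [move=> i _; exact: H|move=> i; exact: H].
  apply: (@fin_bigcap_measurable _ (LT R)); first exact: finite_finset.
  move=> i _.
  have -> : [set t | `|y t 0 i - ratr (q 0 i)| <= r N] =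
     setT `&` (fun t => y t 0 i) @^-1` `[ratr (q 0 i) - r N, ratr (q 0 i) + r N]%classic.
    by apply/seteqP; split => t /=; rewrite in_itv /= ler_distl; [|case].
  by apply: (my i); [exact: measurableT|exact: measurable_itv].
have mnr q N : measurable (nr q N : set (LT R)).
  by apply: measurableI; exact: mnr1.
have H (a : R) : measurable ((`[0, T]%classic `&` [set t | j t (x t) (u t) <= a]) : set (LT R)).
  have -> : `[0, T]%classic `&` [set t | j t (x t) (u t) <= a] =
      \bigcap_N (\bigcup_(q : 'rV[rat]_n * 'rV[rat]_m) (nr q N `&` hit a q N)).
    apply/seteqP; split => t.
      move=> [tT /= ja] N _.
      have [q1 Hq1] := rat_row_approx (x t) (r0 N); have [q2 Hq2] := rat_row_approx (u t) (r0 N).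
      exists (q1, q2) => //; split => //; split => //.
      exists ((x t, u t), a); split => //; have rr : r N < r N + r N by rewrite ltrDl.
      split; last by apply: ballxx; rewrite addr_gt0.
      split; rewrite /= -ball_normE /ball_ /= distrC; apply: le_lt_trans rr; apply: mx_norm_le;
        rewrite ?ltW//; move=> i k; rewrite ord1 !mxE; [exact: Hq1|exact: Hq2].
    move=> Ht; have tT : `[0, T]%classic t by have [q _ [_ []]] := Ht 0%N I.
    split => //=; apply/ler_addgt0Pr => e e0.
    have [d d0 Hd] := normal_lsc (x t) (u t) tT (divr_gt0 e0 (ltr0Sn _ 1)).
    (* The epigraph point is within 3 [r N] < d of (x(t), u(t)), and its height exceeds a by less
       than 2 [r N] < e / 2. *)
    pose e' := Num.min (d / 3) (e / 4).
    have e'0 : 0 < e' by rewrite lt_min !divr_gt0.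
    have [N _ /(_ N (leqnn N)) /= HN] := near_infty_natSinv_lt (PosNum e'0).
    have [q _ [[n1 n2] [_ [p [[[b1 b2] b3] pe]]]]] := Ht N I.
    have {}HN : r N < e' := HN.
    move: HN; rewrite lt_min => /andP[rd re].
    have c1 : `|x t - p.1.1| < d.
      rewrite -ball_normE /= in b1.
      apply: (le_lt_trans (ler_distD (map_mx ratr q.1) _ _)).
      have : `|x t - map_mx ratr q.1| <= r N.
        by apply: mx_norm_le; rewrite ?ltW// => i k; rewrite ord1 !mxE; exact: n1.
      lra.
    have c2 : `|u t - p.1.2| < d.
      rewrite -ball_normE /= in b2.
      apply: (le_lt_trans (ler_distD (map_mx ratr q.2) _ _)).
      have : `|u t - map_mx ratr q.2| <= r N.
        by apply: mx_norm_le; rewrite ?ltW// => i k; rewrite ord1 !mxE; exact: n2.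
      lra.
    have := Hd _ _ c1 c2; rewrite /epi /= in pe.
    rewrite /ball /= /ball /= in b3; move: b3; rewrite ltr_distlC => /andP[_ b3]; lra.
  apply: bigcapT_measurable => N; apply: countable_bigcupT_measurable; first exact: countableP.
  by move=> q; apply: measurableI.
apply: (measurability _ (measurable_realfun.RGenOInfty.measurableE R)).
move=> _ [_ [a ->]] <-.
rewrite [X in measurable X](_ : _ = `[0, T]%classic `\` (`[0, T]%classic `&` [set t | j t (x t) (u t) <= a])).
  exact: measurableD.
apply/seteqP; split => t /=; rewrite !in_itv /= andbT.
  by move=> [tT aj]; split => // -[_]; rewrite leNgt aj.
by move=> [tT H']; split => //; rewrite ltNge; apply/negP => ja; apply: H'.
Qed.

End normal_integrand.

(** * Continuity in the state, uniform over the control set *)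

Section uniform_state_continuity.
Variables (R : realType) (n m : nat) (g : 'rV[R]_n -> 'rV[R]_m -> R) (U : set 'rV[R]_m).
Hypothesis cU : compact U.
Hypothesis dg : forall u x, differentiable (fun y => g y u) x.
Hypothesis cg : forall w : 'rV[R]_n,
  continuous (fun p : 'rV[R]_n * 'rV[R]_m => 'D_w (fun y => g y p.2) p.1).

Lemma segment_derive (x w : 'rV[R]_n) u (s : R) :
  is_derive s 1 (fun s : R => g (x + s *: w) u) ('D_w (fun y => g y u) (x + s *: w)).
Proof.
have E : (fun h : R => h^-1 *: (((fun s : R => g (x + s *: w) u) \o shift s) (h *: (1 : R)) - g (x + s *: w) u)) =
   (fun h : R => h^-1 *: (((fun y => g y u) \o shift (x + s *: w)) (h *: w) - g (x + s *: w) u)).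
  apply/funext => h /=; congr (_ *: (g _ _ - _)).
  by rewrite [_%:A]mulr1 scalerDl addrCA.
have dw : derivable (fun y => g y u) (x + s *: w) w by exact: diff_derivable.
split; first by rewrite /derivable E.
by rewrite /derive E.
Qed.

Lemma derive_coord (x w : 'rV[R]_n) u :
  'D_w (fun y => g y u) x = \sum_(i < n) w 0 i * 'D_(delta_mx 0 i) (fun y => g y u) x.
Proof.
rewrite deriveE// {1}(row_sum_delta w) linear_sum; apply: eq_bigr => i _.
by rewrite linearZ deriveE.
Qed.

(** The partial derivatives in the state are jointly continuous, hence bounded on the compact
    product of a box around [xs] with [U]; the mean value theorem along segments gives a Lipschitz
    bound common to all controls. *)
Lemma state_uniform_continuity (xs : 'rV[R]_n) (e : R) : 0 < e ->
  exists2 d, 0 < d & forall x u, U u -> `|x - xs| < d -> `|g x u - g xs u| <= e.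
Proof.
move=> e0.
pose A := [set v : 'rV[R]_n | forall i, `[xs 0 i - 1, xs 0 i + 1]%classic (v ord0 i)].
have cA : compact A.
  by apply: (@rV_compact R n (fun i => `[xs 0 i - 1, xs 0 i + 1]%classic)) => i; exact: segment_compact.
have cK : compact (A `*` U) by exact: compact_setX.
have bnd (i : 'I_n) : exists L, forall p, (A `*` U) p -> `|'D_(delta_mx 0 i) (fun y => g y p.2) p.1| <= L.
  have : compact ((fun p => 'D_(delta_mx 0 i) (fun y => g y p.2) p.1) @` (A `*` U)).
    by apply: continuous_compact => //; apply: continuous_subspaceT; exact: cg.
  move=> /compact_bounded[L [_ HL]]; exists (L + 1) => p Kp.
  by apply: (HL (L + 1)); [rewrite ltrDl|exists p].
have [L HL] := choice bnd.
pose C := \sum_(i < n) `|L i|.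
have C0 : 0 <= C by apply: sumr_ge0.
(* The 1 keeps the segment from [xs] to [x] inside the box. *)
exists (Num.min 1 (e / (C + 1))); first by rewrite lt_min ltr01 divr_gt0// ltr_wpDl.
move=> x u Uu; rewrite lt_min => /andP[x1 xe].
pose w := x - xs; pose h (s : R) := g (xs + s *: w) u.
have ch : {within `[0, 1], continuous h}.
  apply: continuous_subspaceT => s; apply/differentiable_continuous/derivable1_diffP.
  by have [] := segment_derive xs w u s.
have [c] := MVT_segment ler01 (fun s _ => segment_derive xs w u s) ch.
have xw : xs + w = x by rewrite /w addrC subrK.
rewrite in_itv /= => /andP[c0 c1]; rewrite /h subr0 mulr1 scale1r scale0r addr0 xw => ->.
rewrite derive_coord.
have wC : `|\sum_(i < n) w 0 i * 'D_(delta_mx 0 i) (g ^~ u) (xs + c *: w)| <= `|w| * C.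
  apply: (le_trans (ler_norm_sum _ _ _)); rewrite /C mulr_sumr; apply: ler_sum => i _.
  rewrite normrM; apply: ler_pM => //; first exact: mx_norm_ge.
  apply: le_trans (ler_norm (L i)); apply: (HL i (xs + c *: w, u)); split => //= i'.
  have cw : (xs + c *: w) ord0 i' - xs 0 i' = c * w 0 i' by rewrite !mxE; ring.
  rewrite /= in_itv /= -ler_distl cw normrM (ger0_norm c0).
  apply: le_trans (ltW x1); apply: le_trans (mx_norm_ge w 0 i').
  by rewrite ler_piMl.
apply: (le_trans wC).
apply: (@le_trans _ _ (e / (C + 1) * (C + 1))); last by rewrite divfK// gt_eqF// ltr_wpDl.
by apply: ler_pM => //; [exact: ltW|rewrite lerDl].
Qed.

End uniform_state_continuity.

(** * Jensen's inequality for finite combinations *)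

Section finite_jensen.
Variable R : realType.

Lemma convex_set_comb (V : lmodType R) (E : set V) n N (w : nat -> R) (a : nat -> V) :
  (forall x y, E x -> E y -> forall l : R, 0 <= l <= 1 -> E (l *: x + (1 - l) *: y)) ->
  cvxw n N w -> (forall k, E (a k)) -> E (\sum_(0 <= k < N) w k *: a k).
Proof.
move=> cE [w0 _ _ w1] Ea.
have H M : 0 < \sum_(0 <= k < M) w k ->
    E ((\sum_(0 <= k < M) w k)^-1 *: \sum_(0 <= k < M) w k *: a k).
  elim: M => [|M IH]; first by rewrite big_geq// ltxx.
  rewrite !big_nat_recr//=; set s := \sum_(0 <= _ < M) _; set S := \sum_(0 <= _ < M) _ => sw.
  have s0 : 0 <= s by apply: sumr_ge0.
  have sw0 : s + w M != 0 by rewrite gt_eqF.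
  (* The induction runs on normalized partial sums. If the weights so far sum to 0 they all vanish,
     and the new normalized point is [a M] itself. *)
  have [sE|sN] := eqVneq s 0.
    have wk0 k : (k < M)%N -> w k = 0.
      move=> kM; apply/eqP; rewrite eq_le w0 andbT -sE /s.
      rewrite (big_cat_nat (n := k))//= ?(ltnW kM)// (big_ltn kM) addrCA lerDl.
      by rewrite addr_ge0//; apply: sumr_ge0.
    have -> : S = 0.
      by rewrite /S big_nat_cond big1// => k /andP[/andP[_ kM] _]; rewrite wk0// scale0r.
    rewrite sE !add0r scalerA mulVf ?scale1r//.
    by move: sw0; rewrite sE add0r.
  have sp : 0 < s by rewrite lt_neqAle eq_sym sN.
  have := cE _ _ (IH sp) (Ea M) (s / (s + w M)) _.
  rewrite scalerA mulrAC divff// mul1r.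
  have -> : 1 - s / (s + w M) = (s + w M)^-1 * w M by field.
  rewrite -scalerA -scalerDr; apply.
  by apply/andP; split; [exact: divr_ge0 (ltW sp) (ltW sw)|rewrite ler_pdivrMr// mul1r lerDl].
by have := H N; rewrite w1 invr1 scale1r; apply; exact: ltr01.
Qed.

Lemma row_comb m N (w : nat -> R) (u : nat -> 'rV[R]_m) :
  \row_i comb N w (fun k => u k 0 i) = \sum_(0 <= k < N) w k *: u k.
Proof.
by apply/rowP => i; rewrite mxE summxE; apply: eq_bigr => k _; rewrite mxE.
Qed.

(** The points (u k, f (u k)) lie in the epigraph of [f], a convex set; [R^o] makes the product a
    left module. *)
Lemma jensen_comb m (f : 'rV[R]_m -> R) n N (w : nat -> R) (u : nat -> 'rV[R]_m) :
  (forall (x y : 'rV[R]_m) (l : R), 0 <= l <= 1 ->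
     f (l *: x + (1 - l) *: y) <= l * f x + (1 - l) * f y) ->
  cvxw n N w -> f (\row_i comb N w (fun k => u k 0 i)) <= comb N w (fun k => f (u k)).
Proof.
move=> cf W; rewrite row_comb.
pose E := [set p : 'rV[R]_m * R^o | f p.1 <= p.2].
have cE (x y : 'rV[R]_m * R^o) : E x -> E y -> forall l : R, 0 <= l <= 1 -> E (l *: x + (1 - l) *: y).
  move=> Ex Ey l l01; apply: (le_trans (cf _ _ _ l01)); case/andP: l01 => l0 l1.
  by apply: lerD; apply: ler_wpM2l => //; rewrite subr_ge0.
have := @convex_set_comb _ E n N w (fun k => (u k, f (u k) : R^o)) cE W (fun k => lexx _).
rewrite /E /=.
have -> : (\sum_(0 <= k < N) w k *: ((u k, f (u k)) : 'rV[R]_m * R^o)).1 = \sum_(0 <= k < N) w k *: u k.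
  by rewrite (big_morph (fun p : 'rV[R]_m * R^o => p.1) (id1 := 0) (op1 := +%R)).
by rewrite (big_morph (fun p : 'rV[R]_m * R^o => p.2) (id1 := 0) (op1 := +%R)).
Qed.

(** The variance with respect to the weights is nonnegative. *)
Lemma comb_sq n N (w : nat -> R) (a : nat -> R) : cvxw n N w ->
  (comb N w a) ^+ 2 <= comb N w (fun k => a k ^+ 2).
Proof.
move=> W; set c := comb N w a.
have : 0 <= comb N w (fun k => (a k - c) ^+ 2).
  by apply: sumr_ge0 => k _; apply: mulr_ge0; [have [] := W|exact: sqr_ge0].
have -> : (fun k => (a k - c) ^+ 2) = (fun k => (a k ^+ 2 + (- (2 * c)) * a k) + c ^+ 2).
  by apply/funext => k; ring.
rewrite !combD combZ (comb_cst _ W) -/c => H.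
by rewrite -subr_ge0; apply: le_trans H _; rewrite le_eqVlt; apply/orP; left; apply/eqP; ring.
Qed.

Lemma comb_sum (I : Type) (r : seq I) N (w : nat -> R) (a : I -> nat -> R) :
  comb N w (fun k => \sum_(i <- r) a i k) = \sum_(i <- r) comb N w (a i).
Proof.
rewrite /comb exchange_big /=; apply: eq_bigr => k _.
by rewrite mulr_sumr.
Qed.

Lemma int_comb (c : R) M N (w : nat -> R) (f : nat -> R -> R) : (forall k, bmf M (f k)) ->
  I[0, c] (fun s => comb N w (fun k => f k s)) = comb N w (fun k => I[0, c] (f k)).
Proof.
move=> bf; rewrite /comb; elim: N => [|N IH].
  rewrite big_geq// (@eq_Rintegral _ _ _ _ _ (cst 0)); last by move=> s _; rewrite big_geq.
  by rewrite Rintegral_cst ?mul0r//; exact: measurable_itv_Leb.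
rewrite big_nat_recr//= -IH addrC.
have b1 : bmf (\sum_(0 <= k < N) `|w k| * M) (fun s => \sum_(0 <= k < N) w k * f k s).
  split; first by apply: Lmf_sum => k; apply: LmfM; [exact: Lmf_cst|exact: (bf k).1].
  move=> s; apply: (le_trans (ler_norm_sum _ _ _)); apply: ler_sum => k _.
  by rewrite normrM ler_wpM2l// (bf k).2.
rewrite -(int_lin (w N) 0 c (bf N) b1); apply: eq_Rintegral => s _.
by rewrite big_nat_recr//= addrC.
Qed.

End finite_jensen.

(** * Passage to the limit *)

Section limit_control.
Variables (R : realType) (T : R) (m : nat) (U : set 'rV[R]_m) (u : nat -> R -> 'rV[R]_m).
Hypothesis T0 : 0 < T.
Hypothesis cvxU : convex_in U.
Hypothesis cU : compact U.
Hypothesis uU : forall k, ctrl U (u k).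

Lemma limit_control : exists (ns Ns : nat -> nat) (ws : nat -> nat -> R) (us : R -> 'rV[R]_m),
  [/\ forall p, (p <= ns p)%N /\ cvxw (ns p) (Ns p) (ws p), ctrl U us &
   aeL t, 0 <= t <= T -> forall i,
     comb (Ns p) (ws p) (fun k => u k t 0 i) @[p --> \oo] --> us t 0 i].
Proof.
have [M uM] : exists M, forall a, U a -> `|a| <= M.
  have [M [_ HM]] := compact_bounded cU.
  by exists (M + 1) => a Ua; apply: (HM (M + 1)); rewrite ?ltrDl.
have [ns [Ns [ws [W cv]]]] := @convex_ae_cvg R T m u M T0
  (fun k => (uU k).1) (fun k t => uM _ ((uU k).2 t)).
pose v p (t : R) : 'rV[R]_m := \row_i comb (Ns p) (ws p) (fun k => u k t 0 i).
pose E := [set t | 0 <= t <= T /\ forall i, cvgn (fun p => comb (Ns p) (ws p) (fun k => u k t 0 i))].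
(* E differs from [0, T] by a null set, hence is measurable by completeness. *)
have mE : measurable (E : set (LT R)).
  have -> : E = `[0, T]%classic `\` (`[0, T]%classic `&` ~` E).
    apply/seteqP; split => t /=; rewrite in_itv /=; first by move=> Et; split; [exact: Et.1|case].
    by move=> [tT H]; rewrite -(notK (E t)) => nE; apply: H.
  apply: measurableD; first exact: measurable_itv_Leb.
  apply: completed_lebesgue_measure_is_complete.
  have [N [mN N0 HN]] := cv; exists N; split => // t [/=].
  rewrite in_itv /= => tT nE; apply: HN => /= H; apply: nE; split => //; exact: H.
pose g (t : R) : 'rV[R]_m := \row_i limn (fun p => comb (Ns p) (ws p) (fun k => u k t 0 i)).
have gv t i : E t -> comb (Ns p) (ws p) (fun k => u k t 0 i) @[p --> \oo] --> g t 0 i.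
  by move=> [_ H]; rewrite mxE; exact: H.
pose u0 := u 0%N 0.
(* Outside E a fixed value from [U] is used; on E the limit is in [U] because [U] is closed and
   convex. The control is thus in [U] at all times. *)
exists ns, Ns, ws, (fun t => if t \in E then g t else u0); split => //.
  split.
    move=> i.
    have -> : (fun t => (if t \in E then g t else u0) 0 i) =
       (fun t => if t \in E then g t 0 i else u0 0 i) by apply/funext => t; case: ifP.
    apply: (@measurable_fun_if_set _ (LT R) R E (fun t => g t 0 i) (fun=> u0 0 i)); [exact: mE| |exact: Lmf_cst].
    apply: (@measurable_fun_cvg _ (LT R) R E (fun p t => comb (Ns p) (ws p) (fun k => u k t 0 i))).
      move=> p; apply: measurable_funTS; apply: Lmf_sum => k.
      by apply: LmfM; [exact: Lmf_cst|exact: (uU k).1].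
    by move=> t Et; exact: gv.
  move=> t; case: ifPn => [/set_mem Et|_]; last exact: (uU 0%N).2.
  have clU : closed U by apply: compact_closed => //; exact: norm_hausdorff.
  apply: (closed_cvg (fun x => U x) clU (u_ := v ^~ t) (F := \oo)).
    apply: nearW => p; rewrite /v row_comb; apply: (@convex_set_comb _ _ U _ _ _ _ _ (W p).2).
      by move=> x y Ux Uy l l01; exact: cvxU.
    by move=> k; exact: (uU k).2.
  by apply: cvg_mxP => i i'; rewrite ord1; under eq_fun do rewrite mxE; exact: gv.
apply: aeLS cv => t H tT i; have Et : E t by split => //; exact: H.
by rewrite mem_set//; exact: gv.
Qed.

End limit_control.

Lemma cvg_pair_comp (S : Type) (F : set_system S) {FF : Filter F} (V W Z : topologicalType)
    (f : S -> V) (g : S -> W) (h : V * W -> Z) (a : V) (b : W) :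
  f @ F --> a -> g @ F --> b -> {for (a, b), continuous h} ->
  h (f s, g s) @[s --> F] --> h (a, b).
Proof.
move=> fa gb ch; have fg : (f s, g s) @[s --> F] --> (a, b) by exact: cvg_pair.
exact: (cvg_comp _ _ fg ch).
Qed.

Section limit_state.
Variables (R : realType) (n m : nat) (tau T : R).
Hypothesis T0 : 0 < T.
Variable F0 : 'rV[R]_n -> 'rV[R]_n -> 'rV[R]_n.
Variable F1 : 'rV[R]_n -> 'rV[R]_n -> 'M[R]_(n, m).
Variable U : set 'rV[R]_m.
Variable dl : (R -> 'rV[R]_n) -> R -> 'rV[R]_n.
Variable phic : R -> 'rV[R]_n.
Hypothesis cF0 : continuous (fun p : 'rV[R]_n * 'rV[R]_n => F0 p.1 p.2).
Hypothesis cF1 : continuous (fun p : 'rV[R]_n * 'rV[R]_n => F1 p.1 p.2).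

Local Notation G := (Fapp F0 F1).

Lemma FappE x v a i : G x v a 0 i = F0 x v 0 i + \sum_(j < m) F1 x v i j * a 0 j.
Proof. by rewrite !mxE; congr (_ + _); apply: eq_bigr => j _; rewrite !mxE. Qed.

Lemma Fapp_measurable x v u i : cbd x -> cbd v -> ctrl U u ->
  Lmf (fun s => G (x s) (v s) (u s) 0 i).
Proof.
move=> [cx _] [cv _] [mu _].
have -> : (fun s => G (x s) (v s) (u s) 0 i) =
  (fun s => F0 (x s) (v s) 0 i + \sum_(j < m) F1 (x s) (v s) i j * u s 0 j).
  by apply/funext => s; rewrite FappE.
apply: LmfD.
  apply: Lmf_continuous; apply: ((continuous_row (fun s => F0 (x s) (v s))).1 _ i) => s.
  apply: (cvg_pair_comp (h := fun p => F0 p.1 p.2) (cx s) (cv s)); exact: cF0.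
apply: Lmf_sum => j; apply: LmfM => //; apply: Lmf_continuous => s.
apply: (@continuous_comp _ _ _ (fun s => F1 (x s) (v s)) (fun A : 'M[R]_(n, m) => A i j)).
  apply: (cvg_pair_comp (h := fun p => F1 p.1 p.2) (cx s) (cv s)); exact: cF1.
exact: coord_continuous.
Qed.

Variables K C0 : R.
Hypothesis GK : forall x y v w a B, U a -> `|x - y| <= B -> `|v - w| <= B ->
  `|G x v a - G y w a| <= K * B.
Hypothesis GC : forall a, U a -> `|G 0 0 a| <= C0.
Hypothesis dl_lip : forall x y B t, cbd x -> cbd y ->
  (forall s, t - tau <= s <= t -> `|x s - y s| <= B) -> `|dl x t - dl y t| <= B.
Hypothesis dl_cbd : forall x, cbd x -> cbd (dl x).
Variables (x : nat -> R -> 'rV[R]_n) (u : nat -> R -> 'rV[R]_m) (xs : R -> 'rV[R]_n)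
  (us : R -> 'rV[R]_m) (B Mu : R).
Hypothesis UM : forall a, U a -> `|a| <= Mu.
Hypothesis cx : forall k, cbd (x k).
Hypothesis cu : forall k, ctrl U (u k).
Hypothesis cxs : cbd xs.
Hypothesis cus : ctrl U us.
Hypothesis xB : forall k t, `|x k t| <= B.
Hypothesis xsol : forall k t, x k t = vol T G dl phic (u k) (x k) t.
Hypothesis xcv : forall k t, `|xs t - x k t| <= k.+1%:R^-1.
Variables (ns Ns : nat -> nat) (ws : nat -> nat -> R).
Hypothesis W : forall p, (p <= ns p)%N /\ cvxw (ns p) (Ns p) (ws p).
Hypothesis ucv : aeL t, 0 <= t <= T -> forall i,
     comb (Ns p) (ws p) (fun k => u k t 0 i) @[p --> \oo] --> us t 0 i.

Lemma cvg_harmonic_bound (V : normedModType R) (a : nat -> V) (l : V) :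
  (forall k, `|l - a k| <= k.+1%:R^-1) -> a k @[k --> \oo] --> l.
Proof.
move=> H; apply/cvgrPdist_le => e e0.
have [N _ HN] := near_infty_natSinv_lt (PosNum e0).
by exists N => // k /= Nk; apply: (le_trans (H k)); apply: ltW; exact: HN.
Qed.

Lemma cvg_bigsum (I : Type) (r : seq I) (f : I -> nat -> R) (l : I -> R) :
  (forall i, f i @ \oo --> l i) -> \sum_(i <- r) f i p @[p --> \oo] --> \sum_(i <- r) l i.
Proof.
move=> fl; elim: r => [|i r IH].
  by rewrite big_nil; under eq_fun do rewrite big_nil; exact: cvg_cst.
by rewrite big_cons; under eq_fun do rewrite big_cons; exact: cvgD.
Qed.

(** The integral equations of all the states are averaged with the weights. On the left the states
    converge; on the right the F0 term converges outright, the F1 term is a convergent factor times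
    the averaged control, and dominated convergence moves the limit inside. *)
Lemma limit_state t : xs t = vol T G dl phic us xs t.
Proof.
have [M HM] := rhs_bound (tau := tau) GK GC dl_lip dl_cbd B.
have HMk k := HM (u k) (x k) (cu k) (cx k) (xB k).
have br k i : bmf M (fun s => rhs G dl (u k) (x k) s 0 i).
  by apply: (rhs_bmf (U := U)) => //; exact: Fapp_measurable.
apply/rowP => i; rewrite [RHS]mxE [X in _ + X]mxE; set c := clamp 0 T t.
have /andP[c0 cT] : 0 <= c <= T := clamp_bound t (ltW T0).
have L1 : comb (Ns p) (ws p) (fun k => x k t 0 i - phic t 0 i) @[p --> \oo] --> xs t 0 i - phic t 0 i.
  apply: comb_cvg => //; apply: cvgB; last exact: cvg_cst.
  apply: cvg_harmonic_bound => k; apply: le_trans (xcv k t).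
  by have := mx_norm_ge (xs t - x k t) 0 i; rewrite !mxE.
have E p : comb (Ns p) (ws p) (fun k => x k t 0 i - phic t 0 i) =
    I[0, c] (fun s => comb (Ns p) (ws p) (fun k => rhs G dl (u k) (x k) s 0 i)).
  rewrite (int_comb c (Ns p) (ws p) (fun k => br k i)); congr comb; apply/funext => k.
  by rewrite {1}(xsol k t) /vol [in LHS]mxE [X in _ + X - _]mxE addrAC subrr add0r.
have L2 : comb (Ns p) (ws p) (fun k => x k t 0 i - phic t 0 i) @[p --> \oo] -->
    I[0, c] (fun s => rhs G dl us xs s 0 i).
  under eq_fun do rewrite E.
  apply: (@int_cvg _ M).
  - move=> p; split.
      by apply: Lmf_sum => k; apply: LmfM; [exact: Lmf_cst|exact: (br k i).1].
    by move=> s; apply: comb_norm_le (W p).2 _ => k _; exact: (br k i).2.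
  - by apply: Fapp_measurable => //; exact: dl_cbd.
  apply: aeLS ucv => s H /andP[s0 sc].
  have {}H := H (introT andP (conj s0 (le_trans sc cT))).
  have cv1 : x k s @[k --> \oo] --> xs s by apply: cvg_harmonic_bound => k; exact: xcv.
  have cv2 : dl (x k) s @[k --> \oo] --> dl xs s.
    by apply: cvg_harmonic_bound => k; apply: dl_lip.
  have -> : (fun p => comb (Ns p) (ws p) (fun k => rhs G dl (u k) (x k) s 0 i)) =
     (fun p => comb (Ns p) (ws p) (fun k => F0 (x k s) (dl (x k) s) 0 i) +
       \sum_(j < m) comb (Ns p) (ws p) (fun k => F1 (x k s) (dl (x k) s) i j * u k s 0 j)).
    apply/funext => p; rewrite -comb_sum -combD; congr comb; apply/funext => k.
    by rewrite /rhs FappE.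
  rewrite /rhs FappE.
  apply: cvgD.
    apply: comb_cvg => //.
    apply: (cvg_pair_comp (h := fun p => F0 p.1 p.2 0 i) cv1 cv2).
    apply: (@continuous_comp _ _ _ (fun p : 'rV[R]_n * 'rV[R]_n => F0 p.1 p.2) (fun A : 'rV[R]_n => A 0 i)).
      exact: cF0.
    exact: coord_continuous.
  apply: cvg_bigsum => j; apply: (comb_cvg_mul W _ _ (H j)); last first.
    by move=> k; exact: le_trans (mx_norm_ge _ _ _) (UM ((cu k).2 s)).
  apply: (cvg_pair_comp (h := fun p => F1 p.1 p.2 i j) cv1 cv2).
  apply: (@continuous_comp _ _ _ (fun p : 'rV[R]_n * 'rV[R]_n => F1 p.1 p.2) (fun A : 'M[R]_(n, m) => A i j)).
    exact: cF1.
  exact: coord_continuous.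
have EI := cvg_unique (@Rhausdorff R) L1 L2.
by rewrite -EI addrC subrK.
Qed.

End limit_state.

(** * Existence of a minimizer *)

Section existence.
Variables (R : realType) (n m : nat) (T delta : R).
Variable F0 : 'rV[R]_n -> 'rV[R]_n -> 'rV[R]_n.
Variable F1 : 'rV[R]_n -> 'rV[R]_n -> 'M[R]_(n, m).
Variable U : set 'rV[R]_m.
Variable dl : (R -> 'rV[R]_n) -> R -> 'rV[R]_n.
Variable phic : R -> 'rV[R]_n.
Variable j : R -> 'rV[R]_n -> 'rV[R]_m -> R.
Variable ub : R -> 'rV[R]_m.
Local Notation G := (Fapp F0 F1).
Hypothesis cU : compact U.
Hypothesis Hj : j_assumptions T j.
Hypothesis cub : ctrl U ub.

Definition admissible u x := [/\ ctrl U u, cbd x, forall t, x t = vol T G dl phic u x t &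
  L2ball T delta ub u].

Lemma sqn_ge0 (a : 'rV[R]_m) : 0 <= sqn a.
Proof. by apply: sumr_ge0 => i _; exact: sqr_ge0. Qed.

Lemma Lmf_sqn (u : R -> 'rV[R]_m) : (forall i, Lmf (fun t => u t 0 i)) -> Lmf (fun t => sqn (u t - ub t)).
Proof.
move=> mu; apply: Lmf_sum => i.
have m1 : Lmf (fun t => (u t - ub t) 0 i).
  have -> : (fun t => (u t - ub t) 0 i) = (fun t => u t 0 i - ub t 0 i).
    by apply/funext => t; rewrite !mxE.
  by apply: LmfB; [exact: mu|exact: cub.1].
exact: LmfM.
Qed.

Lemma measurable_cost u x : ctrl U u -> cbd x ->
  measurable_fun (`[0, T]%classic : set (LT R)) (fun t => j t (x t) (u t) + 2^-1 * sqn (u t - ub t)).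
Proof.
move=> cu cx; have [_ [nj _]] := Hj.
apply: measurable_funD.
  apply: measurable_normal_comp => //; last exact: cu.1.
  by move=> i; apply: Lmf_continuous; exact: (continuous_row _).1 cx.1 i.
apply: measurable_funTS; apply: LmfM; first exact: Lmf_cst.
exact: Lmf_sqn cu.1.
Qed.

Lemma cost_ge0 (t : R) (x : 'rV[R]_n) (a b : 'rV[R]_m) : 0 <= j t x a + 2^-1 * sqn (a - b).
Proof. by have [j0 _] := Hj; rewrite addr_ge0// mulr_ge0// sqn_ge0. Qed.

Lemma sqn_comb nn N (w : nat -> R) (a : nat -> 'rV[R]_m) (b : 'rV[R]_m) : cvxw nn N w ->
  sqn ((\row_i comb N w (fun k => a k 0 i)) - b) <= comb N w (fun k => sqn (a k - b)).
Proof.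
move=> W; rewrite /sqn comb_sum; apply: ler_sum => i _.
have -> : ((\row_i0 comb N w (fun k => a k 0 i0)) - b) 0 i = comb N w (fun k => (a k - b) 0 i).
  rewrite !mxE -[X in _ - X](comb_cst (b 0 i) W) -combB; congr comb.
  by apply/funext => k; rewrite !mxE.
exact: comb_sq W.
Qed.

Variables (ns Ns : nat -> nat) (ws : nat -> nat -> R).
Hypothesis W : forall p, (p <= ns p)%N /\ cvxw (ns p) (Ns p) (ws p).

(** The squared norm of the averaged control converges by continuity and lies below the average of
    the squared norms by convexity. *)
Lemma sqn_liminf (a : nat -> 'rV[R]_m) (as_ b : 'rV[R]_m) (e : R) : 0 < e ->
  (forall i, comb (Ns p) (ws p) (fun k => a k 0 i) @[p --> \oo] --> as_ 0 i) ->
  \forall p \near \oo, sqn (as_ - b) - e <= comb (Ns p) (ws p) (fun k => sqn (a k - b)).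
Proof.
move=> e0 H.
have cv : sqn ((\row_i comb (Ns p) (ws p) (fun k => a k 0 i)) - b) @[p --> \oo] --> sqn (as_ - b).
  apply: cvg_bigsum => i.
  have -> : (fun p => ((\row_i0 comb (Ns p) (ws p) (fun k => a k 0 i0)) - b) 0 i ^+ 2) =
    (fun p => (comb (Ns p) (ws p) (fun k => a k 0 i) - b 0 i) * (comb (Ns p) (ws p) (fun k => a k 0 i) - b 0 i)).
    by apply/funext => p; rewrite !mxE.
  have -> : (as_ - b) 0 i ^+ 2 = (as_ 0 i - b 0 i) * (as_ 0 i - b 0 i) by rewrite !mxE.
  by apply: cvgM; apply: cvgB => //; exact: cvg_cst.
have /cvgrPdist_le/(_ _ e0)[N _ HN] := cv.
exists N => // p /= Np; apply: le_trans (sqn_comb _ _ (W p).2).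
have := HN p Np; rewrite ler_distl => /andP[_]; lra.
Qed.

(** [j] is convex in the control only, so the state is frozen at [xs] before Jensen. The losses are
    e / 4 for freezing, e / 4 for lower semicontinuity at the limit control, and half of e / 4 for
    the quadratic term. *)
Lemma cost_liminf t (x : nat -> 'rV[R]_n) (xs : 'rV[R]_n) (a : nat -> 'rV[R]_m) (as_ b : 'rV[R]_m) (e : R) :
  0 <= t <= T -> 0 < e -> (forall k, U (a k)) -> (forall k, `|xs - x k| <= k.+1%:R^-1) ->
  (forall i, comb (Ns p) (ws p) (fun k => a k 0 i) @[p --> \oo] --> as_ 0 i) ->
  \forall p \near \oo, j t xs as_ + 2^-1 * sqn (as_ - b) - e <=
     comb (Ns p) (ws p) (fun k => j t (x k) (a k) + 2^-1 * sqn (a k - b)).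
Proof.
move=> tT e0 Ua xk ak; have [_ [nj [cj [dj ccj]]]] := Hj.
have e40 : 0 < e / 4 by rewrite divr_gt0.
have tT' : `[0, T]%classic t by rewrite /= in_itv.
have [d1 d10 Hd1] := state_uniform_continuity cU (dj t) (ccj t) xs e40.
have [d2 d20 Hd2] := normal_lsc nj xs as_ tT' e40.
have cv : (\row_i comb (Ns p) (ws p) (fun k => a k 0 i)) @[p --> \oo] --> as_.
  by apply: cvg_mxP => i i'; rewrite ord1; under eq_fun do rewrite mxE; exact: ak.
have /cvgrPdist_lt/(_ _ d20)[N2 _ HN2] := cv.
have [N1 _ HN1] := near_infty_natSinv_lt (PosNum d10).
have [N3 _ HN3] := sqn_liminf b e40 ak.
exists (maxn N1 (maxn N2 N3)) => // p /=; rewrite !geq_max => /and3P[p1 p2 p3].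
have [pn Wp] := W p.
rewrite combD combZ.
have h1 : comb (Ns p) (ws p) (fun k => j t xs (a k) - e / 4) <= comb (Ns p) (ws p) (fun k => j t (x k) (a k)).
  apply: comb_le Wp _ => k nk.
  have kd : `|x k - xs| < d1.
    rewrite distrC; apply: (le_lt_trans (xk k)); apply: HN1 => /=.
    exact: leq_trans p1 (leq_trans pn nk).
  by have := Hd1 _ _ (Ua k) kd; rewrite ler_distl => /andP[]; lra.
have h2 := jensen_comb a (fun u v l => cj t xs u v l) Wp.
have h3 : j t xs as_ - e / 4 < j t xs (\row_i comb (Ns p) (ws p) (fun k => a k 0 i)).
  by apply: Hd2; [rewrite subrr normr0|exact: HN2].
have h4 := HN3 p p3.
move: h1; rewrite combB (comb_cst _ Wp); move: h2 h3 h4.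
move: (comb (Ns p) (ws p) (fun k => j t xs (a k))) (j t xs (\row_i _)) (sqn (as_ - b)) => q1 q2 q3.
lra.
Qed.

End existence.

Section minimizer.
Variables (R : realType) (n m : nat) (tau T delta : R).
Hypothesis T0 : 0 < T.
Variable F0 : 'rV[R]_n -> 'rV[R]_n -> 'rV[R]_n.
Variable F1 : 'rV[R]_n -> 'rV[R]_n -> 'M[R]_(n, m).
Variable U : set 'rV[R]_m.
Variable dl : (R -> 'rV[R]_n) -> R -> 'rV[R]_n.
Variable phic : R -> 'rV[R]_n.
Variable j : R -> 'rV[R]_n -> 'rV[R]_m -> R.
Variable ub : R -> 'rV[R]_m.
Hypothesis cF0 : continuous (fun p : 'rV[R]_n * 'rV[R]_n => F0 p.1 p.2).
Hypothesis cF1 : continuous (fun p : 'rV[R]_n * 'rV[R]_n => F1 p.1 p.2).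
Variables K C0 : R.
Hypothesis K0 : 0 < K.
Local Notation G := (Fapp F0 F1).
Hypothesis GK : forall x y v w a B, U a -> `|x - y| <= B -> `|v - w| <= B ->
  `|G x v a - G y w a| <= K * B.
Hypothesis GC : forall a, U a -> `|G 0 0 a| <= C0.
Hypothesis dl_lip : forall x y B t, cbd x -> cbd y ->
  (forall s, t - tau <= s <= t -> `|x s - y s| <= B) -> `|dl x t - dl y t| <= B.
Hypothesis dl_cbd : forall x, cbd x -> cbd (dl x).
Hypothesis phic_cbd : cbd phic.
Hypothesis cvxU : convex_in U.
Hypothesis cU : compact U.
Hypothesis Hj : j_assumptions T j.
Hypothesis cub : ctrl U ub.

Local Notation adm := (admissible T delta F0 F1 U dl phic ub).

Let Gm x v u i : cbd x -> cbd v -> ctrl U u -> Lmf (fun s => G (x s) (v s) (u s) 0 i).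
Proof. exact: Fapp_measurable. Qed.

Lemma admissible_ex : exists u x, adm u x.
Proof.
have [x cx xE] := picard (tau := tau) T0 K0 GK GC Gm dl_lip dl_cbd phic_cbd cub.
exists ub, x; split => //; rewrite /L2ball integral0_eq ?lee_fin ?sqr_ge0// => t _.
by rewrite subrr /sqn big1// => i _; rewrite mxE expr0n.
Qed.

Lemma minimizing_limit (u : nat -> R -> 'rV[R]_m) (x : nat -> R -> 'rV[R]_n) (c : R) :
  (forall k, adm (u k) (x k)) ->
  (forall k, (Jk_cost T j ub (x k) (u k) <= (c + k.+1%:R^-1)%:E)%E) ->
  exists us xs, adm us xs /\ (Jk_cost T j ub xs us <= c%:E)%E.
Proof.
move=> ad cost.
have [B HB] := a_priori_bound (tau := tau) T0 K0 GK GC Gm dl_lip dl_cbd phic_cbd.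
have cu k : ctrl U (u k) by have [] := ad k.
have cx k : cbd (x k) by have [] := ad k.
have xE k t : x k t = vol T G dl phic (u k) (x k) t by have [] := ad k.
have xB k t : `|x k t| <= B by exact: HB (cu k) (cx k) (xE k) t.
have [M HM] := rhs_bound (tau := tau) GK GC dl_lip dl_cbd B.
have HMk k := HM (u k) (x k) (cu k) (cx k) (xB k).
have M0 : 0 <= M := le_trans (normr_ge0 _) (HMk 0%N 0).
(* Compactness is applied after removing the fixed history, since only the integral parts are
   equi-Lipschitz on the line. *)
pose z k t := x k t - phic t.
have zB k t : `|z k t| <= M * T by rewrite /z xE; exact: (vol_bound T0 phic Gm dl_cbd t (cu k) (cx k) (HMk k)).
have zM k s t : `|z k s - z k t| <= M * `|s - t|.
  by rewrite /z !xE; exact: (vol_lipschitz T phic Gm dl_cbd s t (cu k) (cx k) (HMk k)).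
have zT k t : z k t = z k (clamp 0 T t).
  by rewrite /z !xE; exact: vol_clamp.
have [zs [sg [sgk zsM zsz]]] := arzela_ascoli T0 M0 zB zM zT.
pose xs t := zs t + phic t.
have xsx p t : `|xs t - x (sg p) t| <= p.+1%:R^-1.
  have -> : xs t - x (sg p) t = zs t - z (sg p) t by rewrite /xs /z opprB addrA addrAC.
  exact: zsz.
have cxs : cbd xs.
  apply: (lipschitz_cbd phic_cbd (M := M) (B := M * T + 1)) => [s t|t].
    by rewrite /xs !addrK.
  rewrite /xs addrK -(subrK (z (sg 0%N) t) (zs t)).
  apply: (le_trans (ler_normD _ _)); rewrite addrC; apply: lerD; first exact: zB.
  by have := zsz 0%N t; rewrite invr1.
have [Mu HMu] : exists Mu, forall a, U a -> `|a| <= Mu.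
  have [M' [_ HM']] := compact_bounded cU.
  by exists (M' + 1) => a Ua; apply: (HM' (M' + 1)); rewrite ?ltrDl.
have [ns [Ns [ws [us [W cus ucv]]]]] := limit_control T0 cvxU cU (fun k => cu (sg k)).
have xsE t : xs t = vol T G dl phic us xs t.
  exact: (limit_state T0 cF0 cF1 GK GC dl_lip dl_cbd HMu (fun k => cx (sg k))
    (fun k => cu (sg k)) cxs cus (fun k => xB (sg k)) (fun k => xE (sg k)) xsx W ucv).
have mi := @measurable_itv_Leb R `[0, T].
have sgp p : (sg p).+1%:R^-1 <= p.+1%:R^-1 :> R.
  by rewrite lef_pV2 ?posrE ?ltr0n// ler_nat ltnS.
exists us, xs; split; last first.
  apply: (@fatou_comb R _ (LT R) (@Leb R) `[0, T]%classic mi ns Ns ws W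
    (fun k t => j t (x (sg k) t) (u (sg k) t) + 2^-1 * sqn (u (sg k) t - ub t))).
  - by move=> k t; exact: (cost_ge0 Hj).
  - by move=> t; exact: (cost_ge0 Hj).
  - by move=> k; exact: (measurable_cost Hj cub).
  - exact: (measurable_cost Hj cub).
  - by move=> k; apply: (le_trans (cost (sg k))); rewrite lee_fin lerD2l.
  apply: aeLS ucv => t H /=; rewrite in_itv /= => tT e e0.
  by apply: (cost_liminf cU Hj W) => //; [move=> k; exact: (cu _).2|exact: H].
split => //.
(* The L^2 ball is closed for the same reason as the cost is lower semicontinuous; its constant
   bound delta^2 fits the form with slack 1/(k + 1). *)
apply: (@fatou_comb R _ (LT R) (@Leb R) `[0, T]%classic mi ns Ns ws W
  (fun k t => sqn (u (sg k) t - ub t))).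
- by move=> k t; exact: sqn_ge0.
- by move=> t; exact: sqn_ge0.
- by move=> k; apply: measurable_funTS; exact: (Lmf_sqn cub (cu (sg k)).1).
- by apply: measurable_funTS; exact: (Lmf_sqn cub cus.1).
- move=> k; have [_ _ _] := ad (sg k); rewrite /L2ball => /le_trans; apply.
  by rewrite lee_fin lerDl invr_ge0.
apply: aeLS ucv => t H /=; rewrite in_itv /= => tT e e0.
by apply: (sqn_liminf W) => //; exact: H.
Qed.

Lemma minimizer_ex : exists us xs, adm us xs /\
  forall u x, adm u x -> (Jk_cost T j ub xs us <= Jk_cost T j ub x u)%E.
Proof.
pose S := [set q | exists u x, adm u x /\ q = Jk_cost T j ub x u].
have Sinf u x : adm u x -> (ereal_inf S <= Jk_cost T j ub x u)%E.
  by move=> a; apply: ereal_inf_lbound; exists u, x.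
have S0 : (0 <= ereal_inf S)%E.
  apply: le_ereal_inf_tmp => _ [u [x [_ ->]]]; apply: integral_ge0 => t _.
  by rewrite lee_fin; exact: (cost_ge0 Hj).
(* When every admissible cost is +oo any admissible pair is optimal, for instance one driven by the
   centre of the ball. *)
have [Soo|Sfin] := eqVneq (ereal_inf S) +oo%E.
  have [u [x a]] := admissible_ex; exists u, x; split => // u' x' /Sinf.
  by rewrite Soo leye_eq => /eqP ->; rewrite leey.
have fS : ereal_inf S \is a fin_num by rewrite ge0_fin_numE// ltey.
have H k : exists ux : (R -> 'rV[R]_m) * (R -> 'rV[R]_n), adm ux.1 ux.2 /\
    (Jk_cost T j ub ux.2 ux.1 <= (fine (ereal_inf S) + k.+1%:R^-1)%:E)%E.
  have k0 : 0 < k.+1%:R^-1 :> R by rewrite invr_gt0 ltr0n.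
  have [_ [u [x [a ->]]] /ltW Hk] := lb_ereal_inf_adherent k0 fS.
  by exists (u, x); split => //; rewrite EFinD fineK.
have [ux Hux] := choice H.
have [us [xs [a le]]] := minimizing_limit (fun k => (Hux k).1) (fun k => (Hux k).2).
exists us, xs; split => // u x /Sinf; apply: le_trans.
by rewrite fineK in le.
Qed.

End minimizer.

(** * Differential and integral form of the state equation *)

Section representatives.
Variables (R : realType) (T : R) (m : nat) (U : set 'rV[R]_m).

(** The control is overwritten by a fixed element of [U] wherever it leaves [U] or time leaves
    [0, T]; completeness keeps it measurable. *)
Lemma feasible_ctrl u : U !=set0 -> feasible T U u ->
  exists2 u', ctrl U u' & aeL t, 0 <= t <= T -> u t = u' t.
Proof.
move=> [u0 Uu0] [mu [_ Uu]].
pose E := [set t | 0 <= t <= T /\ U (u t)].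
have mE : measurable (E : set (LT R)).
  have -> : E = `[0, T]%classic `\` (`[0, T]%classic `&` ~` E).
    apply/seteqP; split => t /=; rewrite in_itv /=; first by move=> Et; split; [exact: Et.1|case].
    by move=> [tT H]; rewrite -(notK (E t)) => nE; apply: H.
  apply: measurableD; first exact: measurable_itv_Leb.
  apply: completed_lebesgue_measure_is_complete.
  have [N [mN N0 HN]] := Uu; exists N; split => // t [/=].
  rewrite in_itv /= => tT nE; apply: HN => /= H; apply: nE; split => //.
  by apply: H; rewrite in_itv.
exists (fun t => if t \in E then u t else u0).
  split; last by move=> t; case: ifPn => // /set_mem[].
  move=> i; have -> : (fun t => (if t \in E then u t else u0) 0 i) =
     (fun t => if t \in E then u t 0 i else u0 0 i) by apply/funext => t; case: ifP.
  apply: (@measurable_fun_if_set _ (LT R) R E (fun t => u t 0 i) (fun=> u0 0 i)); [exact: mE| |exact: Lmf_cst].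
  have : measurable_fun (`[0, T]%classic : set (LT R)) (fun t => u t 0 i).
    by apply/(Lmeasurable_funE _ (measurable_itv _)); exact: mu.
  apply: measurable_funS; first exact: measurable_itv_Leb.
  by move=> t [tT _]; rewrite /= in_itv.
apply: aeLS Uu => t H tT; rewrite mem_set//; split => //.
by apply: H; rewrite /= in_itv.
Qed.

Lemma ctrl_feasible u : compact U -> ctrl U u -> feasible T U u.
Proof.
move=> cU [mu Uu]; split.
  move=> i; apply/(Lmeasurable_funE _ (measurable_itv _)).
  by apply: measurable_funTS; exact: mu.
split; last by apply: aeW => t _; exact: Uu.
have [M' [_ HM']] := compact_bounded cU.
by exists (M' + 1); apply: aeW => t _; apply: (HM' (M' + 1)); rewrite ?ltrDl.
Qed.

Lemma clamp_within (V : topologicalType) (a b : R) (f : R -> V) : a <= b ->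
  {within `[a, b], continuous f} -> continuous (fun t => f (clamp a b t)).
Proof.
move=> ab /subspace_continuousP cf t.
have cab : `[a, b]%classic (clamp a b t) by rewrite /= in_itv /=; exact: clamp_bound.
apply: (cvg_comp _ _ _ (cf _ cab)) => A wA.
rewrite /nbhs /=; change (nbhs t (clamp a b @^-1` A)).
apply: (@filterS _ (nbhs t) _ _ _ _ (@clamp_continuous R a b t _ wA)) => s /= As; apply: As.
by rewrite /= in_itv /=; exact: clamp_bound.
Qed.

Lemma within_cbd (V : normedModType R) (a b : R) (f : R -> V) : a <= b ->
  {within `[a, b], continuous f} -> cbd (fun t => f (clamp a b t)).
Proof.
move=> ab cf; split; first exact: clamp_within.
have : compact (f @` `[a, b]%classic) by apply: continuous_compact => //; exact: segment_compact.
move=> /compact_bounded[M [_ HM]]; exists (M + 1) => t.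
apply: (HM (M + 1)); first by rewrite ltrDl.
by exists (clamp a b t) => //=; rewrite in_itv /=; exact: clamp_bound.
Qed.

End representatives.

Section integral_equation.
Variables (R : realType) (n m : nat) (tau T k : R).
Hypotheses (tau0 : 0 < tau) (T0 : 0 < T) (k0 : 0 < k).
Variable F0 : 'rV[R]_n -> 'rV[R]_n -> 'rV[R]_n.
Variable F1 : 'rV[R]_n -> 'rV[R]_n -> 'M[R]_(n, m).
Variable U : set 'rV[R]_m.
Variable phi : R -> 'rV[R]_n.
Hypothesis cF0 : continuous (fun p : 'rV[R]_n * 'rV[R]_n => F0 p.1 p.2).
Hypothesis cF1 : continuous (fun p : 'rV[R]_n * 'rV[R]_n => F1 p.1 p.2).
Variables K C0 : R.
Local Notation G := (Fapp F0 F1).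
Hypothesis GK : forall x y v w a B, U a -> `|x - y| <= B -> `|v - w| <= B ->
  `|G x v a - G y w a| <= K * B.
Hypothesis GC : forall a, U a -> `|G 0 0 a| <= C0.

Local Notation dl := (@lie R n tau k).
Let phic t := phi (clamp (- tau) 0 t).

Let Gm x v u i : cbd x -> cbd v -> ctrl U u -> Lmf (fun s => G (x s) (v s) (u s) 0 i).
Proof. exact: Fapp_measurable. Qed.

Let dl_lip x y (B t : R) : cbd x -> cbd y ->
  (forall s, t - tau <= s <= t -> `|x s - y s| <= B) -> `|dl x t - dl y t| <= B.
Proof. exact: lie_lipschitz. Qed.

Let dl_cbd x : cbd x -> cbd (dl x).
Proof. exact: lie_cbd. Qed.

Lemma int_point (f : R -> R) (a : R) : Lmf f -> I[a, a] f = 0.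
Proof.
move=> mf; apply/eqP; rewrite -normr_le0.
have := @int_le R `|f a| f a a (lexx a) mf; rewrite subrr mulr0; apply => t.
by move=> /andP[at_ ta]; have -> : t = a by apply/eqP; rewrite eq_le ta.
Qed.

Lemma clamp_neg t : t <= 0 -> clamp 0 T t = 0.
Proof. by move=> t0; rewrite /clamp max_l// ge_min t0 orbT. Qed.

Lemma lie_eq x y t : (forall s, t - tau <= s <= t -> x s = y s) -> dl x t = dl y t.
Proof.
move=> xy; apply/rowP => i; rewrite [LHS]mxE [RHS]mxE; congr (_ * ln _).
by apply: eq_Rintegral => s; rewrite inE /= in_itv /= => /xy ->.
Qed.

(** For s in (0, T) the window [s - tau, s] lies in [-tau, T], so freezing [x] outside that interval
    leaves the delay unchanged, and the Lipschitz form of the fundamental theorem integrates the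
    equation. For t <= 0 the integral is over the single point 0. *)
Lemma solves_vol u u' x : ctrl U u' -> (aeL t, 0 <= t <= T -> u t = u' t) ->
  solves tau T phi dl F0 F1 u x ->
  let x' := fun t => x (clamp (- tau) T t) in
  cbd x' /\ forall t, x' t = vol T G dl phic u' x' t.
Proof.
move=> cu' uu' [cx [[L xL] [dx xphi]]] x'.
have ntau : - tau <= 0 by rewrite oppr_le0 ltW.
have tauT : - tau <= T := le_trans ntau (ltW T0).
have cx' : cbd x' := @within_cbd _ _ _ _ x tauT cx.
split => // t.
have [_ [B xB]] := cx'.
have [M HM] := rhs_bound (tau := tau) GK GC dl_lip dl_cbd B.
have HMx := HM u' x' cu' cx' xB.
have br i : bmf M (fun s => rhs G dl u' x' s 0 i) by exact: (rhs_bmf Gm dl_cbd i cu' cx' HMx).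
have xx' s : - tau <= s <= T -> x' s = x s by move=> sT; rewrite /x' clamp_id.
have x'phi s : s <= 0 -> x' s = phic s.
  move=> s0; rewrite /x' /phic.
  have -> : clamp (- tau) T s = clamp (- tau) 0 s.
    rewrite /clamp; congr Num.max; rewrite !min_r//.
    by rewrite (le_trans s0)// ltW.
  apply: xphi; rewrite /= in_itv /=; apply: clamp_bound.
  by rewrite oppr_le0 ltW.
case: (leP t 0) => t0.
  rewrite x'phi// /vol -[LHS]addr0; congr (_ + _).
  by apply/rowP => i; rewrite !mxE clamp_neg// (int_point 0 (br i).1).
apply/rowP => i; rewrite [RHS]mxE [X in _ + X]mxE.
set c := clamp 0 T t.
have cT : 0 <= c <= T := clamp_bound t (ltW T0).
have -> : x' t = x c.
  congr x; rewrite /c /clamp max_r; last by rewrite le_min tauT ltW// (lt_trans _ t0)// oppr_lt0.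
  by rewrite max_r// le_min !ltW.
have -> : phic t = x 0.
  rewrite /phic /clamp (min_l (ltW t0)) max_r ?oppr_le0 ?(ltW tau0)//.
  by rewrite xphi//= in_itv /= lexx oppr_le0 ltW.
have := @FTC2_lipschitz R (fun s => x s 0 i) (fun s => rhs G dl u' x' s 0 i) L M T T0 _ (br i) _ c cT.
move=> <-; first by rewrite addrC subrK.
- move=> s r sT rT; apply: le_trans (xL s r _ _); rewrite /= ?in_itv //=.
  by have := mx_norm_ge (x s - x r) 0 i; rewrite !mxE.
apply: aeLS (aeLI dx uu') => s [H1 H2] sT; have /andP[s0 s1] := sT.
have sT' : 0 <= s <= T by rewrite !ltW.
have [ds Ds] : is_derive s 1 x (G (x s) (dl x s) (u s)) by apply: H1; rewrite /= in_itv.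
split; first by have /derivable_mxP := ds; apply.
have x's : x' s = x s.
  by apply: xx'; apply/andP; split; [exact: le_trans ntau (ltW s0)|exact: ltW s1].
have lE : dl x' s = dl x s.
  apply: lie_eq => r /andP[r1 r2]; apply: xx'; apply/andP; split; last exact: le_trans r2 (ltW s1).
  by apply: le_trans r1; rewrite lerBrDl subrr ltW.
have -> : rhs G dl u' x' s 0 i = 'D_1 x s 0 i.
  by rewrite Ds /rhs lE -(H2 sT') x's.
by rewrite [in RHS](derive_mx ds) mxE.
Qed.

Lemma vol_solves u x : ctrl U u -> cbd x -> (forall t, x t = vol T G dl phic u x t) ->
  solves tau T phi dl F0 F1 u x.
Proof.
move=> cu cx xE.
have [_ [B xB]] := cx.
have [M HM] := rhs_bound (tau := tau) GK GC dl_lip dl_cbd B.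
have HMx := HM u x cu cx xB.
have br i : bmf M (fun s => rhs G dl u x s 0 i) by exact: (rhs_bmf Gm dl_cbd i cu cx HMx).
have phic0 s : 0 <= s -> phic s = phic 0.
  by move=> s0; rewrite /phic; congr phi; rewrite /clamp !min_l.
split; first by apply: continuous_subspaceT; exact: cx.1.
split.
  exists M => s t; rewrite /= !in_itv /= => /andP[s0 _] /andP[t0 _].
  have -> : x s - x t = (vol T G dl phic u x s - phic s) - (vol T G dl phic u x t - phic t).
    by rewrite -!xE (phic0 s s0) (phic0 t t0) opprB addrA subrK.
  exact: (vol_lipschitz T phic Gm dl_cbd s t cu cx HMx).
split; last first.
  move=> s; rewrite /= in_itv /= => /andP[s1 s0]; rewrite xE /vol (clamp_neg s0).
  rewrite [X in _ + X](_ : _ = 0) ?addr0 /phic ?clamp_id ?s1//.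
  by apply/rowP => i; rewrite !mxE (int_point 0 (br i).1).
have ae : {ae @Leb R, forall t : R, forall i : nat, forall i0 : 'I_n, nat_of_ord i0 = i -> 0 < t ->
    is_derive t 1 (fun v : R => I[0, v] (fun s => rhs G dl u x s 0 i0) : R) (rhs G dl u x t 0 i0)}.
  apply: aeL_forall => i; case: (ltnP i n) => ni; last first.
    by apply: aeW => t i0 ij; move: ni; rewrite -ij leqNgt ltn_ord.
  apply: aeLS (FTC1_ae (br (Ordinal ni))) => t Ht i0 ij.
  by have -> : i0 = Ordinal ni by exact: val_inj.
apply: aeLS ae => t Ht; rewrite /= in_itv /= => /andP[t0 tT].
have dxi i : is_derive t 1 (fun v : R => x v 0 i) (rhs G dl u x t 0 i).
  have d1 : is_derive t 1 (fun v : R => phic 0 0 i + I[0, v] (fun s => rhs G dl u x s 0 i)) (0 + rhs G dl u x t 0 i).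
    by apply: is_deriveD; exact: Ht.
  rewrite -[rhs G dl u x t 0 i]add0r.
  (* Near a time in (0, T) the clamp is the identity and [phic] is constant, so the state is a
     constant plus a primitive. *)
  apply: near_eq_is_derive d1; apply: (@nbhs_interval _ _ t 0%:E T%:E); rewrite ?lte_fin// => s.
  rewrite !lte_fin => s0 sT; rewrite (xE s) /vol [in RHS]mxE [X in _ = _ + X]mxE clamp_id ?phic0 ?ltW//.
have dx : derivable x t 1.
  by apply/derivable_mxP => i i'; rewrite ord1; have [] := dxi i'.
split => //.
rewrite derive_mx//; apply/matrixP => i i'; rewrite ord1 mxE.
by have [_ ->] := dxi i'.
Qed.

End integral_equation.

(** Completeness of [Leb] transfers measurability from [f] to [g], so integrands in the original
    controls can be exchanged for those in their representatives. *)
Lemma ae_eq_integral_Leb (R : realType) (D : set R) (f g : R -> R) : measurable D ->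
  measurable_fun (D : set (LT R)) f -> (aeL t, D t -> f t = g t) ->
  (\int[@Leb R]_(t in D) (f t)%:E = \int[@Leb R]_(t in D) (g t)%:E)%E.
Proof.
move=> mD mf fg; have mD' := borel_Leb mD.
have fgE : ae_eq (@Leb R) (D : set (LT R)) (EFin \o f) (EFin \o g).
  by apply: aeLS fg => t H /= Dt; rewrite H.
have mf' : measurable_fun (D : set (LT R)) (EFin \o f) by exact/measurable_EFinP.
have mg := ae_measurable_fun (@completed_lebesgue_measure_is_complete R) fgE mf'.
exact: (@ae_eq_integral _ (LT R) R (@Leb R) D _ _ mD' mf' mg fgE).
Qed.

(** * Bounds on the dynamics over the control set *)

Section bounds.
Variables (R : realType) (n m : nat).
Variable F0 : 'rV[R]_n -> 'rV[R]_n -> 'rV[R]_n.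
Variable F1 : 'rV[R]_n -> 'rV[R]_n -> 'M[R]_(n, m).
Variable U : set 'rV[R]_m.
Local Notation G := (Fapp F0 F1).

Lemma Fapp_lipschitz (L0 L1 Mu : R) :
  (forall p q : 'rV[R]_n * 'rV[R]_n, `|F0 p.1 p.2 - F0 q.1 q.2| <= L0 * `|p - q|) ->
  (forall p q : 'rV[R]_n * 'rV[R]_n, `|F1 p.1 p.2 - F1 q.1 q.2| <= L1 * `|p - q|) ->
  (forall a, U a -> `|a| <= Mu) ->
  exists2 K, 0 < K & forall x y v w a B, U a -> `|x - y| <= B -> `|v - w| <= B ->
  `|G x v a - G y w a| <= K * B.
Proof.
(* The factor m counts the terms of a row of F1 times the control, as the norm is the max norm; the
   final 1 makes the constant positive. *)
move=> l0 l1 UM; exists (`|L0| + `|L1| * `|Mu| *+ m + 1).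
  by rewrite ltr_wpDl// addr_ge0// mulrn_wge0// mulr_ge0.
move=> x y v w a B Ua xy vw; have B0 : 0 <= B := le_trans (normr_ge0 _) xy.
have pB : `|(x, v) - (y, w)| <= B by exact: pair_norm.
have h0 : `|F0 x v - F0 y w| <= `|L0| * B.
  apply: (le_trans (l0 (x, v) (y, w))); apply: (le_trans (ler_wpM2r (normr_ge0 _) (ler_norm L0))); exact: ler_wpM2l.
apply: mx_norm_le => [|i' i].
  by rewrite mulr_ge0// addr_ge0// addr_ge0// mulrn_wge0// mulr_ge0.
rewrite ord1 mxE [X in _ + X]mxE !FappE opprD addrACA -sumrB.
apply: (le_trans (ler_normD _ _)); rewrite [leRHS]mulrDl mul1r -[leLHS]addr0; apply: lerD => //.
rewrite mulrDl; apply: lerD.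
  by apply: le_trans h0; apply: le_trans (mx_norm_ge _ 0 i); rewrite !mxE.
apply: (le_trans (ler_norm_sum _ _ _)).
have -> : `|L1| * `|Mu| *+ m * B = \sum_(j < m) `|L1| * B * `|Mu|.
  by rewrite sumr_const card_ord mulrnAl mulrAC.
apply: ler_sum => j _; rewrite -mulrBl normrM; apply: ler_pM => //.
  apply: (le_trans _ (le_trans (l1 (x, v) (y, w)) _)).
    by apply: le_trans (mx_norm_ge _ i j); rewrite !mxE.
  exact: le_trans (ler_wpM2r (normr_ge0 _) (ler_norm _)) (ler_wpM2l (normr_ge0 _) pB).
exact: le_trans (mx_norm_ge a 0 j) (le_trans (UM _ Ua) (ler_norm _)).
Qed.

Lemma Fapp0_bound (Mu : R) : (forall a, U a -> `|a| <= Mu) ->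
  exists C0, forall a, U a -> `|G 0 0 a| <= C0.
Proof.
move=> UM; exists (`|F0 0 0| + `|F1 0 0| * `|Mu| *+ m) => a Ua.
apply: mx_norm_le => [|i' i]; first by rewrite addr_ge0// mulrn_wge0// mulr_ge0.
rewrite ord1 FappE; apply: (le_trans (ler_normD _ _)); apply: lerD; first exact: mx_norm_ge.
apply: (le_trans (ler_norm_sum _ _ _)).
have -> : `|F1 0 0| * `|Mu| *+ m = \sum_(j < m) `|F1 0 0| * `|Mu| by rewrite sumr_const card_ord.
apply: ler_sum => j _; rewrite normrM.
apply: ler_pM => //; first exact: mx_norm_ge.
exact: le_trans (mx_norm_ge a 0 j) (le_trans (UM _ Ua) (ler_norm _)).
Qed.

End bounds.

Theorem theorem5p4 (R : realType) (n m : nat) (T tau delta : R)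
  (F0 : 'rV[R]_n -> 'rV[R]_n -> 'rV[R]_n)
  (F1 : 'rV[R]_n -> 'rV[R]_n -> 'M[R]_(n, m))
  (phi : R -> 'rV[R]_n) (U : set 'rV[R]_m)
  (j : R -> 'rV[R]_n -> 'rV[R]_m -> R)
  (xs : R -> 'rV[R]_n) (us : R -> 'rV[R]_m) :
  (0 < n)%N -> (0 < m)%N -> 0 < T -> 0 < tau -> 0 < delta ->
  glob_lipschitz (fun p : 'rV[R]_n * 'rV[R]_n => F0 p.1 p.2) ->
  glob_lipschitz (fun p : 'rV[R]_n * 'rV[R]_n => F1 p.1 p.2) ->
  C1 (fun p : 'rV[R]_n * 'rV[R]_n => F0 p.1 p.2) ->
  C1 (fun p : 'rV[R]_n * 'rV[R]_n => F1 p.1 p.2) ->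
  {within `[- tau, 0]%classic, continuous phi} ->
  U !=set0 -> convex_in U -> compact U ->
  j_assumptions T j ->
  (* (xs, us) is a local solution of (P) with radius delta *)
  feasible T U us ->
  solves tau T phi (@maxd R n tau) F0 F1 us xs ->
  (forall u x, feasible T U u -> L2ball T delta us u ->
     solves tau T phi (@maxd R n tau) F0 F1 u x ->
     (Jcost T j xs us <= Jcost T j x u)%E) ->
  (* then (P_k) has a global solution for every k > 0 *)
  forall k : R, 0 < k ->
  exists (xk : R -> 'rV[R]_n) (uk : R -> 'rV[R]_m),
    feasible T U uk /\ L2ball T delta us uk /\
    solves tau T phi (@lie R n tau k) F0 F1 uk xk /\
    (forall u x, feasible T U u -> L2ball T delta us u ->
       solves tau T phi (@lie R n tau k) F0 F1 u x ->
       (Jk_cost T j us xk uk <= Jk_cost T j us x u)%E).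
Proof.
move=> _ _ T0 tau0 _ [L0 l0] [L1 l1] [dF0 _] [dF1 _] cphi U0 cvxU cU Hj fus _ _ k k0.
have [M' [_ HM']] := compact_bounded cU.
have UM a : U a -> `|a| <= M' + 1 by apply: HM'; rewrite ltrDl.
have [K K0 GK] := Fapp_lipschitz l0 l1 UM.
have [C0 GC] := Fapp0_bound F0 F1 UM.
have cF0 : continuous (fun p : 'rV[R]_n * 'rV[R]_n => F0 p.1 p.2).
  by move=> p; apply: differentiable_continuous; exact: dF0.
have cF1 : continuous (fun p : 'rV[R]_n * 'rV[R]_n => F1 p.1 p.2).
  by move=> p; apply: differentiable_continuous; exact: dF1.
have ntau : - tau <= 0 by rewrite oppr_le0 ltW.
have phic_cbd := within_cbd ntau cphi.
have [us' cus' usE] := feasible_ctrl U0 fus.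
have [uk [xk [[cuk cxk xkE bk] opt]]] := minimizer_ex delta T0 cF0 cF1 K0 GK GC
  (fun x y B t => @lie_lipschitz R n tau k tau0 k0 x y B t)
  (fun x => @lie_cbd R n tau k tau0 k0 x) phic_cbd cvxU cU Hj cus'.
(* The ball and the cost depend on controls only up to null sets, so they can be centred at [us']
   and evaluated at representatives. *)
have ballE u v : ctrl U v -> (aeL t, 0 <= t <= T -> u t = v t) ->
    L2ball T delta us u <-> L2ball T delta us' v.
  move=> cv uv.
  have mv : measurable_fun (`[0, T]%classic : set (LT R)) (fun t => sqn (v t - us' t)).
    by apply: measurable_funTS; exact: (Lmf_sqn cus' cv.1).
  suff E : aeL t, `[0, T]%classic t -> sqn (v t - us' t) = sqn (u t - us t).
    by rewrite /L2ball (ae_eq_integral_Leb (measurable_itv _) mv E).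
  apply: aeLS (aeLI uv usE) => t [H1 H2]; rewrite /= in_itv /= => tT.
  by rewrite H1// H2.
have costE u v x y : ctrl U v -> cbd y -> (aeL t, 0 <= t <= T -> u t = v t) ->
    (forall t, 0 <= t <= T -> x t = y t) ->
    Jk_cost T j us x u = Jk_cost T j us' y v.
  move=> cv cy uv xy; have mc := measurable_cost Hj cus' cv cy.
  suff E : aeL t, `[0, T]%classic t -> j t (y t) (v t) + 2^-1 * sqn (v t - us' t) =
      j t (x t) (u t) + 2^-1 * sqn (u t - us t).
    by rewrite /Jk_cost (ae_eq_integral_Leb (measurable_itv _) mc E).
  apply: aeLS (aeLI uv usE) => t [H1 H2]; rewrite /= in_itv /= => tT.
  by rewrite H1// H2// xy.
have refl : aeL t, 0 <= t <= T -> uk t = uk t by apply: aeW.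
exists xk, uk; split; first exact: ctrl_feasible.
split; first by apply/(ballE uk uk).
split; first exact: (vol_solves tau0 k0 cF0 cF1 GK GC cuk cxk xkE).
move=> u x fu bu sx.
(* A competitor enters the normalized problem through its representative and its clamped state,
   which leave ball and cost unchanged. *)
have [u' cu' uE] := feasible_ctrl U0 fu.
have [cx' xE'] := solves_vol tau0 T0 k0 cF0 cF1 GK GC cu' uE sx.
rewrite (costE uk uk xk xk)// (costE u u' x _ cu' cx' uE).
  by apply: opt; split => //; apply/(ballE u u').
by move=> t /andP[t0 tT]; rewrite clamp_id// tT (le_trans ntau).
Qed.
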